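(* Let $N\ge2$ and let $\Omega\subset\mathbb{R}^N$ be a bounded and smooth domain with distance function to the boundary $\rho(x)=\inf_{y\in\partial\Omega}|y-x|$. Let $x_0\in\Omega$ and let $u_\infty\in C(\overline\Omega)$ be the unique viscosity solution of the Dirichlet problem $$\begin{cases} \Delta_\infty u=0 & \text{in }\Omega\setminus\{x_0\} \\ u=0 & \text{on }\partial\Omega \\ u(x_0)=1. \end{cases}$$ Then: (i) $0<u_\infty(x)<1$ for all $x\in\Omega\setminus\{x_0\}$; (ii) if $x_0$ is a maximum point of the distance function $\rho$, then $\|u_\infty\|_\infty=1$ and $$\|\nabla u_\infty\|_\infty=\frac1{\|\rho\|_\infty}.$$
   Context: $\|\cdot\|_\infty$ denotes the norm of $L^\infty(\Omega)$. For $\phi\in C^2$, $\Delta_\infty\phi(x_0):=\sum_{i,j=1}^N\frac{\partial\phi}{\partial x_i}(x_0)\frac{\partial\phi}{\partial x_j}(x_0)\frac{\partial^2\phi}{\partial x_i\partial x_j}(x_0)$. Let $D$ be a bounded domain and $u\in C(\overline D)$. A function $\phi\in C^2(D)$ touches $u$ at $y\in D$ from below (resp. above) if $\phi(y)=u(y)$ and $\phi(x)<u(x)$ (resp. $\phi(x)>u(x)$) for all $x\in D\setminus\{y\}$. One says that $\Delta_\infty u=0$ in $D$ in the viscosity sense if $\Delta_\infty\phi(y)\ge0$ whenever $\phi\in C^2(D)$ touches $u$ from above at $y\in D$, and $\Delta_\infty\phi(y)\le0$ whenever $\phi\in C^2(D)$ touches $u$ from below at $y\in D$. Boundary values (including at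 $x_0$, with $D=\Omega\setminus\{x_0\}$) are attained pointwise by the continuous function $u$. The Dirichlet problem above has exactly one viscosity solution (known). *)

(* Defs.v *)
From HB Require Import structures.
From mathcomp Require Import all_boot all_order all_algebra.
From mathcomp Require Import all_classical all_reals all_analysis.

Set Implicit Arguments.
Unset Strict Implicit.
Unset Printing Implicit Defensive.

Import Order.TTheory GRing.Theory Num.Theory.
Import numFieldNormedType.Exports.

Local Open Scope classical_set_scope.
Local Open Scope ring_scope.

Definition rV_display : measure_display.
Proof. by constructor. Qed.

(* 'rV[R]_n carries the sigma-algebra generated by the coordinates, which is
   the Borel sigma-algebra of R^n. *)
Section measurable_rV.
Context {R : realType} (n : nat).

Let coord (i : 'I_n) (x : 'rV[R]_n) : measurableTypeR R := x ord0 i.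

Let rV_set0 : g_sigma_preimage coord set0.
Proof. exact: sigma_algebra0. Qed.

Let rV_setC A : g_sigma_preimage coord A -> g_sigma_preimage coord (~` A).
Proof. exact: sigma_algebraC. Qed.

Let rV_bigcup (F : (set 'rV[R]_n)^nat) :
  (forall i, g_sigma_preimage coord (F i)) ->
  g_sigma_preimage coord (\bigcup_i F i).
Proof. exact: sigma_algebra_bigcup. Qed.

HB.instance Definition _ := @isMeasurable.Build rV_display
  'rV[R]_n (g_sigma_preimage coord) rV_set0 rV_setC rV_bigcup.

Lemma measurable_coord (i : 'I_n) :
  measurable_fun [set: 'rV[R]_n] (fun x => x ord0 i : measurableTypeR R).
Proof.
move=> _ Y mY; rewrite setTI; apply: sub_sigma_algebra => /=.
rewrite -bigcup_seq/=; exists i => /=; first by rewrite mem_index_enum.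
by exists Y => //; rewrite setTI.
Qed.

Lemma measurable_fun_rVP d (T : measurableType d) (f : T -> 'rV[R]_n) :
  (forall i, measurable_fun [set: T] (fun x => f x ord0 i : measurableTypeR R)) ->
  measurable_fun [set: T] f.
Proof.
move=> mf _ A mA; rewrite setTI.
suff : g_sigma_preimage (fun i => coord i \o f) `<=` measurable.
  by apply; rewrite g_sigma_preimage_comp; exists A => //; rewrite setTI.
apply: smallest_sub; first exact: sigma_algebra_measurable.
rewrite -bigcup_seq/=; apply: bigcup_sub => i _.
by move=> B [C mC <-]; exact: mf.
Qed.

End measurable_rV.

Section lebesgue_measure_rV.
Context {R : realType}.

Definition cons_rV n (p : measurableTypeR R * 'rV[R]_n) : 'rV[R]_n.+1 :=
  row_mx (p.1 : R)%:M p.2.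

Lemma cons_rV0 n p : @cons_rV n p ord0 ord0 = p.1.
Proof.
rewrite /cons_rV; have -> : ord0 = lshift n (ord0 : 'I_1) by exact: val_inj.
by rewrite (row_mxEl (p.1 : R)%:M) mxE eqxx.
Qed.

Lemma cons_rVS n p j : @cons_rV n p ord0 (lift ord0 j) = p.2 ord0 j.
Proof.
rewrite /cons_rV; have -> : lift ord0 j = rshift 1 j by exact: val_inj.
by rewrite (row_mxEr (p.1 : R)%:M).
Qed.

Lemma measurable_cons_rV n : measurable_fun setT (@cons_rV n).
Proof.
apply: measurable_fun_rVP => i; case: (unliftP ord0 i) => [j|] ->.
  under eq_fun do rewrite cons_rVS.
  exact: (measurableT_comp (measurable_coord j) measurable_snd).
under eq_fun do rewrite cons_rV0.
exact: measurable_fst.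
Qed.

Section step.
Context n (mu : {sigma_finite_measure set 'rV[R]_n -> \bar R}).

Definition lebesgue_cons : set 'rV[R]_n.+1 -> \bar R :=
  pushforward (@lebesgue_measure R \x mu)%E (@cons_rV n).

Let preim_meas (A : set 'rV[R]_n.+1) : measurable A ->
  measurable (@cons_rV n @^-1` A).
Proof. by move=> mA; rewrite -[X in measurable X]setTI; exact: measurable_cons_rV. Qed.

Let lebesgue_cons0 : lebesgue_cons set0 = 0%E.
Proof. by rewrite /lebesgue_cons /pushforward preimage_set0 measure0. Qed.

Let lebesgue_cons_ge0 A : (0 <= lebesgue_cons A)%E.
Proof. by rewrite /lebesgue_cons /pushforward; exact: measure_ge0. Qed.

Let lebesgue_cons_sigma_additive : semi_sigma_additive lebesgue_cons.
Proof.
move=> F mF tF mUF; rewrite /lebesgue_cons /pushforward preimage_bigcup.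
apply: measure_semi_sigma_additive.
- by move=> k; exact: preim_meas.
- apply/trivIsetP => /= i j _ _ ij; rewrite -preimage_setI.
  by move/trivIsetP : tF => /(_ _ _ _ _ ij) ->//; rewrite preimage_set0.
- by rewrite -preimage_bigcup; exact: preim_meas.
Qed.

HB.instance Definition _ := isMeasure.Build _ _ _ lebesgue_cons
  lebesgue_cons0 lebesgue_cons_ge0 lebesgue_cons_sigma_additive.

Lemma lebesgue_consE (A : set R) (B : set 'rV[R]_n) :
  measurable (A : set (measurableTypeR R)) -> measurable B ->
  lebesgue_cons [set x | A (x ord0 ord0) /\ B (\row_j x ord0 (lift ord0 j))] =
  (lebesgue_measure A * mu B)%E.
Proof.
move=> mA mB; rewrite -product_measure1E// /lebesgue_cons /pushforward.
congr (_ _); apply/seteqP; split=> -[a b] /=; rewrite cons_rV0.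
all: rewrite (_ : \row_j _ = b)//.
all: by apply/rowP => j; rewrite mxE cons_rVS.
Qed.

Let measurable_cyl (A : set R) (B : set 'rV[R]_n) :
  measurable (A : set (measurableTypeR R)) -> measurable B ->
  measurable [set x : 'rV[R]_n.+1 |
    A (x ord0 ord0) /\ B (\row_j x ord0 (lift ord0 j))].
Proof.
move=> mA mB; apply: (@measurableI _ _ (_ @^-1` A) (_ @^-1` B)).
  rewrite -[X in measurable X]setTI.
  exact: (measurable_coord (ord0 : 'I_n.+1)).
rewrite -[X in measurable X]setTI.
suff : measurable_fun [set: 'rV[R]_n.+1] (fun x => \row_j x ord0 (lift ord0 j)).
  by move=> m; exact: m.
apply: measurable_fun_rVP => i; under eq_fun do rewrite mxE.
exact: measurable_coord.
Qed.

Let lebesgue_cons_sigma_finite : sigma_finite setT lebesgue_cons.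
Proof.
have /sigma_finiteP[F [TF ndF Foo]] := sigma_finiteT (@lebesgue_measure R).
have /sigma_finiteP[G [TG ndG Goo]] := sigma_finiteT mu.
exists (fun k => [set x : 'rV[R]_n.+1 | F k (x ord0 ord0) /\
                          G k (\row_j x ord0 (lift ord0 j))]).
  rewrite predeqE => x; split=> // _.
  have : [set: measurableTypeR R] (x ord0 ord0) by [].
  rewrite TF => -[i _ Fi].
  have : [set: 'rV[R]_n] (\row_j x ord0 (lift ord0 j)) by [].
  rewrite TG => -[k _ Gk].
  exists (maxn i k) => //; split.
    by move: Fi; exact/subsetPset/ndF/leq_maxl.
  by move: Gk; exact/subsetPset/ndG/leq_maxr.
move=> k; have [mF Fk] := Foo k; have [mG Gk] := Goo k.
split; first exact: measurable_cyl.
by rewrite lebesgue_consE// lte_mul_pinfty// ge0_fin_numE.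
Qed.

HB.instance Definition _ := Measure_isSigmaFinite.Build _ _ _ lebesgue_cons
  lebesgue_cons_sigma_finite.

End step.

Fixpoint lebesgue_rV n : {sigma_finite_measure set 'rV[R]_n -> \bar R} :=
  match n with
  | 0 => @dirac _ 'rV[R]_0 0 R
  | m.+1 => lebesgue_cons (lebesgue_rV m)
  end.

Lemma lebesgue_rV_box n (A : 'I_n -> set (measurableTypeR R)) :
  (forall i, measurable (A i)) ->
  lebesgue_rV n [set x | forall i, A i (x ord0 i)] =
  (\prod_(i < n) lebesgue_measure (A i))%E.
Proof.
elim: n A => [|n IH] A mA /=.
  rewrite big_ord0 diracE mem_set//; by case.
rewrite big_ord_recl -IH//.
have mB : measurable [set y : 'rV[R]_n | forall i, A (lift ord0 i) (y ord0 i)].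
  rewrite (_ : [set y | _] = \bigcap_(i in [set: 'I_n])
      ((fun y : 'rV[R]_n => y ord0 i) @^-1` A (lift ord0 i))); last first.
    by apply/seteqP; split=> y /= h i => [_|]; exact: h.
  apply: fin_bigcap_measurable => [|i _]; first exact: finite_finset.
  by rewrite -[X in measurable X]setTI; exact: measurable_coord.
rewrite -lebesgue_consE//; congr (lebesgue_cons _ _).
apply/seteqP; split=> x /=.
  by move=> h; split=> // i; rewrite mxE.
move=> [h0 h] i; case: (unliftP ord0 i) => [j|] -> //.
by move: (h j); rewrite mxE.
Qed.

End lebesgue_measure_rV.

Section calculus.
Context {R : realType} {N : nat}.
Implicit Types (D : set 'rV[R]_N) (f u : 'rV[R]_N -> R) (x y : 'rV[R]_N).

(* The library norm on 'rV is the sup norm, which gives the right topology but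
   not the Euclidean length. *)
Definition enorm x : R := Num.sqrt (\sum_i x ord0 i ^+ 2).

Definition basis (i : 'I_N) : 'rV[R]_N := delta_mx ord0 i.

Definition partial (i : 'I_N) f : 'rV[R]_N -> R := fun x => 'D_(basis i) f x.

(* Class C^k on D in terms of iterated partial derivatives; meant for D open. *)
Fixpoint Ck (k : nat) D f : Prop :=
  (forall x, D x -> {for x, continuous f}) /\
  match k with
  | 0 => True
  | k'.+1 => forall i, (forall x, D x -> derivable f x (basis i)) /\
                       Ck k' D (partial i f)
  end.

Definition smooth D f : Prop := forall k, Ck k D f.

Definition inf_laplacian f x : R :=
  \sum_i \sum_j partial i f x * partial j f x * partial i (partial j f) x.

Definition boundary D : set 'rV[R]_N := closure D `\` interior D.

Definition is_domain D : Prop := [/\ D !=set0, open D & connected D].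

(* Every boundary point has a neighbourhood U in which D is a strict sublevel
   set {f < 0} of a smooth f whose gradient does not vanish there. *)
Definition smooth_boundary D : Prop :=
  forall y, boundary D y -> exists (U : set 'rV[R]_N) f,
    [/\ open U, U y, smooth U f, exists i, partial i f y != 0 &
        D `&` U = [set x | f x < 0] `&` U].

Definition dist_boundary D x : R :=
  inf [set enorm (y - x) | y in boundary D].

Definition touches_above D u f y : Prop :=
  f y = u y /\ forall x, D x -> x != y -> u x < f x.

Definition touches_below D u f y : Prop :=
  f y = u y /\ forall x, D x -> x != y -> f x < u x.

Definition inf_harmonic D u : Prop :=
  (forall f y, Ck 2 D f -> D y -> touches_above D u f y ->
     0 <= inf_laplacian f y) /\
  (forall f y, Ck 2 D f -> D y -> touches_below D u f y ->
     inf_laplacian f y <= 0).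

Definition dirichlet_solution D x0 u : Prop :=
  [/\ {within closure D, continuous u},
      inf_harmonic (D `\ x0) u,
      forall x, boundary D x -> u x = 0 &
      u x0 = 1].

(* The L^oo(D) norm, as that of the extension of f by 0 outside D. *)
Definition Linf_norm D f : \bar R :=
  ('N[lebesgue_rV N]_+oo [EFin \o (f \_ D)])%E.

Definition locally_integrable_rV D f : Prop :=
  measurable_fun D f /\
  forall K : set 'rV[R]_N, compact K -> K `<=` D ->
    (lebesgue_rV N).-integrable K (EFin \o f).

Definition test_function D f : Prop :=
  [/\ smooth setT f, compact (closure [set x | f x != 0]) &
      closure [set x | f x != 0] `<=` D].

Definition weak_gradient D u (g : 'rV[R]_N -> 'rV[R]_N) : Prop :=
  locally_integrable_rV D u /\
  forall i, locally_integrable_rV D (fun x => g x ord0 i) /\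
    forall f, test_function D f ->
      \int[lebesgue_rV N]_(x in D) (u x * partial i f x) =
      - \int[lebesgue_rV N]_(x in D) (g x ord0 i * f x).

End calculus.

(* Main.v *)
(* Testing the viscosity inequalities with perturbed cones, u and -u are compared
   with cones a + b|x - z|, b > 0.  Comparison gives 0 <= u <= 1; comparison on
   punctured balls propagates an extremal value to a neighbourhood, whence (i).
   Cones centred at x0, at boundary points and at interior points, all of slope
   L = 1 / dist(x0, boundary), show that the extension U of u by 0 is L-Lipschitz
   on R^N.
   Its weak gradient comes from difference quotients: the limits of their
   integrals over measurable sets, along a free ultrafilter, form a charge
   dominated by Lebesgue measure, linear in the direction, and the Radon-Nikodym
   densities are the components of a weak gradient with norm at most L a.e.
   Conversely, an a.e. bound L' for the gradient bounds the increments of averages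
   of U along segments in the domain; a segment from x0 to almost a nearest
   boundary point, along which U drops from 1 to almost 0, gives 1 <= L' / L. *)

Require Import Defs.
From HB Require Import structures.
From mathcomp Require Import all_boot all_order all_algebra.
From mathcomp Require Import all_classical all_reals all_analysis.
From mathcomp Require Import measurable_realfun ring lra.

Set Implicit Arguments.
Unset Strict Implicit.
Unset Printing Implicit Defensive.

Import Order.TTheory GRing.Theory Num.Theory.
Import numFieldNormedType.Exports.

Local Open Scope classical_set_scope.
Local Open Scope ring_scope.

(** * The Euclidean norm and radial functions *)

(** Two obstacles shape the proof. A cone has zero infinity Laplacian and is singular at its vertex,
    so as a test function it contradicts nothing: it is bent into a smooth strict supersolution away
    from the vertex, and the vertex is removed from the set of comparison. And the gradient is
    controlled only almost everywhere, which says nothing about a single segment, so increments are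
    averaged over a ball that moves along the segment. The slope L = 1 / dist(x0, boundary) is the
    least one for which 1 - L|x - x0| is nonpositive on the boundary. This lower cone is in turn
    what makes cones with an interior vertex admissible at x0, hence the Lipschitz bound with the
    same L. U is never differentiated pointwise. Linearity in the direction is proved for the limit
    charges and then passed to their densities, so that one vector field serves all directions; this
    gives the bound L for its Euclidean norm and not merely for each component. The result is a
    gradient norm 1 / dist(x0, boundary), and maximality of x0 identifies that distance with the sup
    norm of the distance function. *)

Section enorm.
Context {R : realType} {N : nat}.
Implicit Types x y v : 'rV[R]_N.

Definition dot x y : R := \sum_i x ord0 i * y ord0 i.

Lemma dotDl x y v : dot (x + y) v = dot x v + dot y v.
Proof.
by rewrite /dot -big_split; apply: eq_bigr => i _; rewrite mxE mulrDl.
Qed.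

Lemma dotZl c x v : dot (c *: x) v = c * dot x v.
Proof.
by rewrite /dot mulr_sumr; apply: eq_bigr => i _; rewrite mxE mulrA.
Qed.

Lemma dotC x y : dot x y = dot y x.
Proof. by apply: eq_bigr => i _; rewrite mulrC. Qed.

Lemma dotDr x y v : dot v (x + y) = dot v x + dot v y.
Proof. by rewrite dotC dotDl !(dotC v). Qed.

Lemma dotZr c x v : dot v (c *: x) = c * dot v x.
Proof. by rewrite dotC dotZl !(dotC v). Qed.

Lemma dot_ge0 x : 0 <= dot x x.
Proof. by apply: sumr_ge0 => i _; rewrite -expr2 sqr_ge0. Qed.

Lemma enormE x : enorm x = Num.sqrt (dot x x).
Proof. by congr Num.sqrt; apply: eq_bigr => i _; rewrite expr2. Qed.

Lemma enorm_ge0 x : 0 <= enorm x.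
Proof. exact: sqrtr_ge0. Qed.

Lemma sqr_enorm x : enorm x ^+ 2 = dot x x.
Proof. by rewrite enormE sqr_sqrtr// dot_ge0. Qed.

Lemma enormZ c x : enorm (c *: x) = `|c| * enorm x.
Proof.
by rewrite !enormE dotZl dotZr mulrA -expr2 sqrtrM ?sqr_ge0// sqrtr_sqr.
Qed.

Lemma enorm0 : enorm (0 : 'rV[R]_N) = 0.
Proof. by rewrite -(scale0r 0) enormZ normr0 mul0r. Qed.

Lemma enormN x : enorm (- x) = enorm x.
Proof. by rewrite -scaleN1r enormZ normrN1 mul1r. Qed.

Lemma enormB x y : enorm (x - y) = enorm (y - x).
Proof. by rewrite -enormN opprB. Qed.

Lemma enorm_coord x i : `|x ord0 i| <= enorm x.
Proof.
rewrite -sqrtr_sqr /enorm ler_sqrt; last by apply: sumr_ge0 => j _; exact: sqr_ge0.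
by rewrite (bigD1 i)//= lerDl sumr_ge0// => j _; exact: sqr_ge0.
Qed.

Lemma enorm_eq0 x : (enorm x == 0) = (x == 0).
Proof.
apply/eqP/eqP => [x0|->]; last exact: enorm0.
apply/rowP => i; rewrite mxE; apply/eqP; rewrite -normr_le0 -x0.
exact: enorm_coord.
Qed.

Lemma enorm_gt0 x : (0 < enorm x) = (x != 0).
Proof. by rewrite lt_neqAle enorm_ge0 andbT eq_sym enorm_eq0. Qed.

Lemma cauchy_schwarz x y : `|dot x y| <= enorm x * enorm y.
Proof.
have [->|x0] := eqVneq x 0.
  rewrite enorm0 mul0r -(scale0r (0 : 'rV[R]_N)) dotZl mul0r normr0//.
have X0 : 0 < dot x x by rewrite -sqr_enorm exprn_gt0// enorm_gt0.
rewrite -ler_sqr ?nnegrE ?mulr_ge0 ?enorm_ge0 ?normr_ge0//.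
rewrite exprMn !sqr_enorm real_normK ?num_real//.
have := dot_ge0 (dot x x *: y - dot x y *: x).
rewrite -scaleNr !(dotDl, dotDr, dotZl, dotZr) (dotC y x) => h.
have : 0 <= dot x x * (dot x x * dot y y - dot x y ^+ 2).
  by move: h; congr (_ <= _); ring.
by rewrite pmulr_rge0// subr_ge0.
Qed.

Lemma ler_enormD x y : enorm (x + y) <= enorm x + enorm y.
Proof.
rewrite -ler_sqr ?nnegrE ?addr_ge0 ?enorm_ge0//.
rewrite sqrrD !sqr_enorm !(dotDl, dotDr) (dotC y x).
have := le_trans (ler_norm _) (cauchy_schwarz x y); lra.
Qed.

Lemma ler_enorm_dist x y v : enorm (x - y) <= enorm (x - v) + enorm (v - y).
Proof. by have := ler_enormD (x - v) (v - y); rewrite addrA subrK. Qed.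

Lemma norm_le_enorm x : `|x| <= enorm x.
Proof.
rewrite [leLHS]/Num.Def.normr/= mx_normrE; apply/bigmax_leP; split=> [|[i j] _ /=].
  exact: enorm_ge0.
by rewrite ord1; exact: enorm_coord.
Qed.

Lemma coord_le_norm x i : `|x ord0 i| <= `|x|.
Proof.
by rewrite [leRHS]/Num.Def.normr/= mx_normrE; apply/bigmax_geP; right; exists (ord0, i).
Qed.

Lemma enorm_le_norm x : enorm x <= N%:R * `|x|.
Proof.
rewrite -ler_sqr ?nnegrE ?mulr_ge0 ?enorm_ge0 ?normr_ge0//.
rewrite sqr_enorm exprMn.
apply: (@le_trans _ _ (N%:R * `|x| ^+ 2)).
  rewrite /dot mulr_natl -[X in _ *+ X]card_ord -sumr_const; apply: ler_sum => i _.
  by rewrite -expr2 -real_normK ?num_real// ler_sqr ?nnegrE// coord_le_norm.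
apply: ler_wpM2r; first exact: sqr_ge0.
by rewrite -natrX ler_nat; case: (N) => // n; rewrite expnS leq_pmulr.
Qed.

Lemma ler_dist_enorm x y : `|enorm x - enorm y| <= enorm (x - y).
Proof.
rewrite ler_norml lerBlDr lerBrDl -[X in _ && X](lerD2r 0).
have := ler_enorm_dist x 0 y; have := ler_enorm_dist y 0 x.
rewrite !subr0 (enormB y x) => h1 h2; apply/andP; split; lra.
Qed.

Lemma lipschitz_continuous (f : 'rV[R]_N -> R) (L : R) :
  (forall x y, `|f x - f y| <= L * enorm (x - y)) -> continuous f.
Proof.
move=> Lf x; apply/(@cvgrPdist_le _ _ _ (nbhs x)) => e e0.
(* The added ones keep the divisor [M] positive when [L] or [N] is 0. *)
pose M := (`|L| + 1) * (N%:R + 1).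
have M0 : 0 < M by rewrite mulr_gt0// ltr_wpDl.
have h : \forall y \near x, `|x - y| <= e / M.
  have : nbhs x (ball x (e / M)) by apply: nbhsx_ballx; rewrite divr_gt0.
  by apply: filterS => y; rewrite -ball_normE => /ltW.
apply: filterS h => y xy; apply: (le_trans (Lf _ _)).
apply: (@le_trans _ _ (M * `|x - y|)); last by rewrite mulrC -ler_pdivlMr.
rewrite -mulrA; apply: (@le_trans _ _ ((`|L| + 1) * enorm (x - y))).
  by apply: ler_wpM2r; rewrite ?enorm_ge0// (le_trans (ler_norm _))// lerDl.
apply: ler_wpM2l; first by rewrite addr_ge0.
by rewrite (le_trans (enorm_le_norm _))// ler_wpM2r// lerDl.
Qed.

Lemma enorm_continuous : continuous (@enorm R N).
Proof.
apply: (@lipschitz_continuous _ 1) => x y; rewrite mul1r; exact: ler_dist_enorm.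
Qed.

End enorm.

(** * Explicit derivatives of radial functions *)

Section derivative_data.
Context {R : realType} {N : nat}.
Implicit Types (x y z v : 'rV[R]_N) (i j : 'I_N).

(** Restricting to a line turns directional derivatives into one-variable ones, to which the usual
    chain rule applies. *)
Lemma is_derive_lineP (f : 'rV[R]_N -> R) x v (d : R) :
  is_derive x v f d <-> is_derive (0 : R) 1 (fun h : R => f (h *: v + x)) d.
Proof.
have E : 'D_v f x = 'D_1 (fun h : R => f (h *: v + x)) 0.
  rewrite /derive; set g1 := fun h => h^-1 *: _; set g2 := fun h => h^-1 *: _.
  suff -> : g1 = g2 by [].
  apply/funext => h; rewrite /g1 /g2 /=.
  by rewrite addr0 scale0r add0r [_%:A]mulr1.
split=> -[df dfE]; split.
- exact: (derivable1P f x v).1.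
- by rewrite -E.
- exact: (derivable1P f x v).2.
- by rewrite E.
Qed.

(** Radial functions are written through the squared distance because it is smooth at the centre
    too. *)
Definition sqdist z x : R := dot (x - z) (x - z).

Lemma sqdist_ge0 z x : 0 <= sqdist z x.
Proof. exact: dot_ge0. Qed.

Lemma sqdistE z x : sqdist z x = enorm (x - z) ^+ 2.
Proof. by rewrite sqr_enorm. Qed.

Lemma dot_basisr x i : dot x (Defs.basis i) = x ord0 i.
Proof.
rewrite /dot (bigD1 i)//= mxE !eqxx mulr1 big1 ?addr0// => j ji.
by rewrite mxE (negbTE ji) andbF mulr0.
Qed.

Lemma is_derive_coord x i j :
  is_derive x (Defs.basis i) (fun y => y ord0 j) (i == j)%:R.
Proof.
apply/is_derive_lineP.
rewrite (_ : (fun h => _) = (fun h : R => h * (i == j)%:R + x ord0 j)); last first.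
  by apply/funext => h; rewrite !mxE eqxx/= (eq_sym j).
by apply: is_derive_eq; rewrite addr0 [_ *: _]mulr0 add0r [_ *: _]mulr1.
Qed.

Lemma is_derive_comp1 (P : R -> R) (f : 'rV[R]_N -> R) x v (a b : R) :
  is_derive (f x) 1 P a -> is_derive x v f b ->
  is_derive x v (fun y => P (f y)) (a * b).
Proof.
move=> dP /is_derive_lineP df; apply/is_derive_lineP.
apply: (@is_derive1_comp _ P (fun h => f (h *: v + x)) 0 a b).
by rewrite scale0r add0r.
Qed.

Lemma is_derive_mul (f g : 'rV[R]_N -> R) x v (df dg : R) :
  is_derive x v f df -> is_derive x v g dg ->
  is_derive x v (fun y => f y * g y) (f x * dg + g x * df).
Proof. by move=> hf hg; apply: is_deriveM. Qed.

Lemma is_derive_add (f g : 'rV[R]_N -> R) x v (df dg : R) :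
  is_derive x v f df -> is_derive x v g dg ->
  is_derive x v (fun y => f y + g y) (df + dg).
Proof. by move=> hf hg; apply: is_deriveD. Qed.

Lemma is_derive_sqdist z x i :
  is_derive x (Defs.basis i) (sqdist z) (2 * (x - z) ord0 i).
Proof.
have -> : sqdist z = \sum_j (fun y => (y - z) ord0 j ^+ 2).
  by apply/funext => y; rewrite fct_sumE; apply: eq_bigr => j _; rewrite expr2.
have h j : is_derive x (Defs.basis i) (fun y => (y - z) ord0 j ^+ 2)
    (2 * (x - z) ord0 j * (i == j)%:R).
  rewrite (_ : (fun y => _) = (fun y : 'rV[R]_N => (y ord0 j - z ord0 j) * (y ord0 j - z ord0 j))); last first.
    by apply/funext => y; rewrite !mxE expr2.
  have d : is_derive x (Defs.basis i) (fun y : 'rV[R]_N => y ord0 j - z ord0 j) (i == j)%:R.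
    by apply: is_derive_eq; first exact: is_derive_add (is_derive_coord x i j) (is_derive_cst _ _ _); rewrite addr0.
  apply: (is_derive_eq (is_derive_mul d d)).
  by rewrite !mxE; ring.
apply: (is_derive_eq (is_derive_sum h)).
rewrite (bigD1 i)//= eqxx mulr1 big1 ?addr0// => j ji.
by rewrite eq_sym (negbTE ji) mulr0.
Qed.

(** Carrying the gradient [G] and the Hessian [H] as data makes the infinity Laplacian of a test
    function an algebraic expression. *)
Definition C2_data (f : 'rV[R]_N -> R) (G : 'I_N -> 'rV[R]_N -> R)
    (H : 'I_N -> 'I_N -> 'rV[R]_N -> R) : Prop :=
  [/\ continuous f, forall i, continuous (G i), forall i j, continuous (H i j),
      forall i x, is_derive x (Defs.basis i) f (G i x) &
      forall i j x, is_derive x (Defs.basis i) (G j) (H i j x)].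

Lemma C2_dataE f G H : C2_data f G H ->
  (forall D, Ck 2 D f) /\
  forall x, inf_laplacian f x = \sum_i \sum_j G i x * G j x * H i j x.
Proof.
move=> [cf cG cH dG dH].
have pG i : partial i f = G i by apply/funext => x; case: (dG i x).
have pH i j : partial i (G j) = H i j by apply/funext => x; case: (dH i j x).
split=> [D|x].
  split=> [x _|i]; first exact: cf.
  split=> [x _|]; first by case: (dG i x).
  rewrite pG; split=> [x _|j]; first exact: cG.
  split=> [x _|]; first by case: (dH j i x).
  by rewrite pH; split=> // x _; exact: cH.
by apply: eq_bigr => i _; apply: eq_bigr => j _; rewrite !pG pH.
Qed.

Lemma C2_data_add f G H f' G' H' : C2_data f G H -> C2_data f' G' H' ->
  C2_data (fun x => f x + f' x) (fun i x => G i x + G' i x)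
          (fun i j x => H i j x + H' i j x).
Proof.
move=> [cf cG cH dG dH] [cf' cG' cH' dG' dH']; split.
- by move=> x; apply: continuousD; [exact: cf|exact: cf'].
- by move=> i x; apply: continuousD; [exact: cG|exact: cG'].
- by move=> i j x; apply: continuousD; [exact: cH|exact: cH'].
- by move=> i x; exact: is_derive_add.
- by move=> i j x; exact: is_derive_add.
Qed.

Lemma continuous_mul (f g : 'rV[R]_N -> R) :
  continuous f -> continuous g -> continuous (fun x => f x * g x).
Proof. by move=> cf cg x; exact: (@continuousM _ _ f g x (cf x) (cg x)). Qed.

Lemma continuous_add (f g : 'rV[R]_N -> R) :
  continuous f -> continuous g -> continuous (fun x => f x + g x).
Proof. by move=> cf cg x; exact: (@continuousD _ _ _ f g x (cf x) (cg x)). Qed.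

Lemma continuous_sqdist z : continuous (sqdist z).
Proof.
have -> : sqdist z = (fun x => enorm (x - z) * enorm (x - z)).
  by apply/funext => x; rewrite sqdistE expr2.
have h : continuous (fun y => enorm (y - z)).
  move=> x; apply: continuous_comp; last exact: enorm_continuous.
  by apply: continuousB; [exact: cvg_id|exact: cst_continuous].
exact: continuous_mul.
Qed.

Lemma continuous_coord1 z i : continuous (fun x : 'rV[R]_N => (x - z) ord0 i).
Proof.
rewrite (_ : (fun x => _) = (fun x : 'rV[R]_N => x ord0 i - z ord0 i)); last first.
  by apply/funext => x; rewrite !mxE.
by move=> x; apply: continuousB; [exact: coord_continuous|exact: cst_continuous].
Qed.

(** The one-variable hypotheses are confined to w >= 0, the range of [sqdist], because the profile
    used later contains a square root that is not smooth on the whole line. *)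
Lemma C2_data_radial (P P1 P2 : R -> R) z :
  (forall w : R, 0 <= w -> is_derive w 1 P (P1 w)) ->
  (forall w : R, 0 <= w -> is_derive w 1 P1 (P2 w)) ->
  (forall w : R, 0 <= w -> {for w, continuous P2}) ->
  C2_data (fun x => P (sqdist z x))
    (fun i x => P1 (sqdist z x) * (2 * (x - z) ord0 i))
    (fun i j x => P1 (sqdist z x) * (2 * (i == j)%:R) +
       2 * (x - z) ord0 j * (P2 (sqdist z x) * (2 * (x - z) ord0 i))).
Proof.
move=> dP dP1 cP2.
have cd (Q Q1 : R -> R) (w : R) : is_derive w 1 Q (Q1 w) -> {for w, continuous Q}.
  by move=> -[h _]; apply: differentiable_continuous; exact/derivable1_diffP.
have cP (w : R) : 0 <= w -> {for w, continuous P} by move=> /dP; exact: cd.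
have cP1 (w : R) : 0 <= w -> {for w, continuous P1} by move=> /dP1; exact: cd.
have cc (Q : R -> R) : (forall w : R, 0 <= w -> {for w, continuous Q}) ->
    continuous (fun x => Q (sqdist z x)).
  move=> cQ x; apply: continuous_comp; first exact: continuous_sqdist.
  by apply: cQ; exact: sqdist_ge0.
have cl i : continuous (fun x : 'rV[R]_N => 2 * (x - z) ord0 i).
  apply: (@continuous_mul (fun=> 2)); last exact: continuous_coord1.
  by move=> x; exact: cst_continuous.
have d i j x : is_derive x (Defs.basis i) (fun y => 2 * (y - z) ord0 j)
    (2 * (i == j)%:R).
  rewrite (_ : (fun y => _) = (fun y : 'rV[R]_N => 2 * y ord0 j + (- 2 * z ord0 j))); last first.
    by apply/funext => y; rewrite !mxE; ring.
  apply: (is_derive_eq (is_derive_add (is_derive_mul (is_derive_cst _ _ _) (is_derive_coord x i j)) (is_derive_cst _ _ _))).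
  by rewrite mulr0 !addr0.
split.
- exact: cc.
- by move=> i; exact: (continuous_mul (cc _ cP1) (cl i)).
- move=> i j; apply: continuous_add; apply: continuous_mul => //.
  + exact: cc.
  + by move=> x; exact: cst_continuous.
  + by apply: continuous_mul => //; exact: cc.
- move=> i x; apply: is_derive_comp1; last exact: is_derive_sqdist.
  by apply: dP; exact: sqdist_ge0.
- move=> i j x; apply: is_derive_mul; last first.
    apply: is_derive_comp1; last exact: is_derive_sqdist.
    by apply: dP1; exact: sqdist_ge0.
Qed.

End derivative_data.

(** * Topology expressed with the Euclidean norm *)

Section epsilon_delta.
Context {R : realType} {N : nat}.
Implicit Types (x y z v : 'rV[R]_N) (A : set 'rV[R]_N).

Lemma nbhs_enormP x A :
  nbhs x A <-> exists2 d : R, 0 < d & forall y, enorm (y - x) < d -> A y.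
Proof.
split=> [/nbhs_ballP[d /= d0 dA]|[d d0 dA]].
  exists d => // y yd; apply: dA; rewrite -ball_normE/= distrC.
  exact: le_lt_trans (norm_le_enorm _) yd.
apply/nbhs_ballP; exists (d / (N%:R + 1)) => /=.
  by rewrite divr_gt0// ltr_wpDl.
move=> y; rewrite -ball_normE/= distrC => yd; apply: dA.
apply: (le_lt_trans (enorm_le_norm _)).
rewrite -(@ltr_pM2l _ (N%:R + 1)) ?ltr_wpDl// in yd.
rewrite mulrCA mulfV ?mulr1 in yd; last by rewrite gt_eqF// ltr_wpDl.
by apply: le_lt_trans yd; rewrite ler_wpM2r// lerDl.
Qed.

Lemma within_continuousP A (f : 'rV[R]_N -> R) :
  {within A, continuous f} <-> forall x, A x -> forall e : R, 0 < e ->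
    exists2 d : R, 0 < d &
      forall y, A y -> enorm (y - x) < d -> `|f y - f x| < e.
Proof.
split.
  move=> /subspace_continuousP cf x Ax e e0.
  have /cvgrPdist_lt/(_ _ e0) := cf _ Ax.
  move=> /nbhs_enormP[d d0 dA]; exists d => // y Ay yd.
  by rewrite distrC; exact: dA.
move=> cf; apply/subspace_continuousP => x Ax; apply/cvgrPdist_lt => e e0.
have [d d0 dA] := cf x Ax e e0.
apply/nbhs_enormP; exists d => // y yd Ay.
by rewrite distrC; exact: dA.
Qed.

Lemma closure_enormP A x :
  closure A x <-> forall d : R, 0 < d -> exists2 y, A y & enorm (y - x) < d.
Proof.
split=> [cA d d0|h B /nbhs_enormP[d d0 dB]].
  have /cA[y [Ay yd]] : nbhs x [set y | enorm (y - x) < d].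
    by apply/nbhs_enormP; exists d.
  by exists y.
by have [y Ay yd] := h d d0; exists y; split=> //; exact: dB.
Qed.

Lemma openP A : open A <->
  forall x, A x -> exists2 d : R, 0 < d & forall y, enorm (y - x) < d -> A y.
Proof.
rewrite openE; split=> h x Ax; first by apply/nbhs_enormP; exact: h.
by apply/nbhs_enormP; exact: h.
Qed.

Lemma open_setC1 y : open [set~ y].
Proof.
apply/openP => x /eqP xy; exists (enorm (x - y)).
  by rewrite enorm_gt0 subr_eq0.
by move=> w wx wy; move: wx; rewrite wy enormB ltxx.
Qed.

Lemma bounded_enormP A : bounded_set A <->
  exists2 M : R, 0 < M & forall x, A x -> enorm x <= M.
Proof.
split=> [[M [Mr hM]]|[M M0 hM]].
  exists (N%:R * (`|M| + 1) + 1) => [|x Ax].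
    by rewrite ltr_wpDl// mulr_ge0// addr_ge0.
  apply: (le_trans (enorm_le_norm _)); apply: ler_wpDr => //.
  apply: ler_wpM2l => //; apply: hM Ax.
  by apply: (le_lt_trans (ler_norm _)); rewrite ltrDl.
exists M; split; first exact: num_real.
move=> y My x Ax; apply: (le_trans (norm_le_enorm _)).
by apply: (le_trans (hM _ Ax)); exact: ltW.
Qed.

Lemma bounded_closure A : bounded_set A -> bounded_set (closure A).
Proof.
move=> /bounded_enormP[M M0 hM]; apply/bounded_enormP; exists (M + 1) => [|x].
  by rewrite addr_gt0.
move=> /closure_enormP/(_ _ ltr01)[y Ay yx].
have := ler_enormD (x - y) y; rewrite subrK (enormB x) => h.
by apply: (le_trans h); rewrite addrC lerD ?hM// ltW.
Qed.

Lemma compact_closure A : bounded_set A -> compact (closure A).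
Proof.
move=> bA; apply: bounded_closed_compact; last exact: closed_closure.
exact: bounded_closure.
Qed.

Lemma enorm_line x d (s t : R) :
  enorm (x + s *: d - (x + t *: d)) = `|s - t| * enorm d.
Proof. by rewrite opprD addrACA subrr add0r -scalerBl enormZ. Qed.

Lemma near_line x d (t r : R) : 0 < r -> exists2 e : R, 0 < e &
  forall s, `|s - t| < e -> enorm (x + s *: d - (x + t *: d)) < r.
Proof.
move=> r0; have d1 : 0 < enorm d + 1 by rewrite ltr_wpDl// enorm_ge0.
exists (r / (enorm d + 1)) => [|s st]; first by rewrite divr_gt0.
rewrite enorm_line (@le_lt_trans _ _ (`|s - t| * (enorm d + 1)))//.
  by rewrite ler_wpM2l// lerDl.
by rewrite -ltr_pdivlMr.
Qed.

End epsilon_delta.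

(** * Comparison with cones *)

Section cone_comparison.
Context {R : realType} {N : nat}.
Implicit Types (x y z : 'rV[R]_N) (D V : set 'rV[R]_N) (v : 'rV[R]_N -> R).

(** The half of the viscosity condition that comparison from above consumes, tested with functions
    that are C^2 on the whole space. It is shared by u and -u. *)
Definition inf_subharmonic D v : Prop := forall f G H y,
  C2_data f G H -> D y -> touches_above D v f y ->
  0 <= \sum_i \sum_j G i y * G j y * H i j y.

Lemma inf_harmonic_sub D v : inf_harmonic D v -> inf_subharmonic D v.
Proof.
move=> [hv _] f G H y fGH Dy fy; have [hCk <-] := C2_dataE fGH; exact: hv.
Qed.

(** The infinity Laplacian is cubic in f, hence odd, so touching v from below becomes touching -v
    from above. *)
Lemma inf_harmonic_subN D v :
  inf_harmonic D v -> inf_subharmonic D (fun x => - v x).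
Proof.
move=> [_ hv] f G H y fGH Dy [fy flt].
have CN : C2_data (fun x => - f x) (fun i x => - G i x) (fun i j x => - H i j x).
  case: fGH => cf cG cH dG dH; split.
  - by move=> x; apply: continuousN; exact: cf.
  - by move=> i x; apply: continuousN; exact: cG.
  - by move=> i j x; apply: continuousN; exact: cH.
  - by move=> i x; exact: is_deriveN.
  - by move=> i j x; exact: is_deriveN.
have [hCk hlap] := C2_dataE CN.
have : inf_laplacian (fun x => - f x) y <= 0.
  apply: hv => //; split=> [|x Dx xy]; first by rewrite fy opprK.
  by rewrite ltrNl; exact: flt.
rewrite hlap -oppr_ge0 -sumrN; congr (_ <= _); apply: eq_bigr => i _.
by rewrite -sumrN; apply: eq_bigr => j _; rewrite mulrNN mulrN opprK.
Qed.

(* Adding K |x - y|^4 makes the maximum strict and global without changing the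
   derivatives of order at most two at y. *)
Lemma radial_touch D v z (P P1 P2 : R -> R) (M e : R) y :
  (forall w : R, 0 <= w -> is_derive w 1 P (P1 w)) ->
  (forall w : R, 0 <= w -> is_derive w 1 P1 (P2 w)) ->
  (forall w : R, 0 <= w -> {for w, continuous P2}) ->
  inf_subharmonic D v -> D y ->
  (forall x, D x -> v x - P (sqdist z x) <= M) ->
  0 < e ->
  (forall x, D x -> enorm (x - y) < e ->
    v x - P (sqdist z x) <= v y - P (sqdist z y)) ->
  forall w, w = sqdist z y -> 0 <= P1 w ^+ 2 * w * (P1 w + 2 * w * P2 w).
Proof.
move=> dP dP1 cP2 subv Dy leM e0 locmax w hw.
set m := v y - P (sqdist z y) in locmax.
(* With K e^4 = |M - m| + 1 the quartic exceeds M - m outside the ball of radius e, where only the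
   global bound M is available. *)
pose K : R := (`|M - m| + 1) / e ^+ 4.
have K0 : 0 < K by rewrite divr_gt0 ?exprn_gt0// ltr_wpDl.
pose Q (t : R) : R := K * t ^+ 2 + m.
pose Q1 (t : R) : R := 2 * K * t.
pose Q2 (t : R) : R := 2 * K.
have dQ (t : R) : is_derive t 1 Q (Q1 t).
  rewrite /Q; apply: is_derive_eq; rewrite /Q1.
  by rewrite addr0 [t%:A]mulr1 -[_ *: _]/(K * (t + t)); ring.
have dQ1 (t : R) : is_derive t 1 Q1 (Q2 t).
  by rewrite /Q1; apply: is_derive_eq; rewrite [_ *: _]mulr1.
have C1 := C2_data_radial z dP dP1 cP2.
have C2 := C2_data_radial y (fun t _ => dQ t) (fun t _ => dQ1 t)
   (fun t _ => @cst_continuous _ _ (2 * K) t).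
have yy : sqdist y y = 0 by rewrite sqdistE subrr enorm0 expr0n.
have Cadd := C2_data_add C1 C2.
have := subv _ _ _ y Cadd Dy.
set T := touches_above _ _ _ _; have HT : T.
  split.
    by rewrite yy /Q expr0n mulr0 add0r /m addrC subrK.
  move=> x Dx xy.
  have nxy : 0 < enorm (x - y) by rewrite enorm_gt0 subr_eq0.
  rewrite -ltrBlDl /Q.
  have [xe|xe] := ltP (enorm (x - y)) e.
    apply: (le_lt_trans (locmax _ Dx xe)); rewrite ltrDr.
    by rewrite mulr_gt0// sqdistE !exprn_gt0.
  apply: (le_lt_trans (leM _ Dx)).
  rewrite -ltrBlDr; apply: (@lt_le_trans _ _ (K * e ^+ 4)).
    rewrite /K -mulrA mulVf ?mulr1; last by rewrite gt_eqF// exprn_gt0.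
    by rewrite (le_lt_trans (ler_norm _))// ltrDl.
  rewrite ler_pM2l// sqdistE -exprM; apply: lerXn2r => //; rewrite nnegrE.
    exact: ltW.
  exact: enorm_ge0.
move=> /(_ HT).
(* At y the quartic drops out, since [Q1] vanishes at 0 and y - y = 0. What remains is the infinity
   Laplacian of the radial function, 8 P1^2 w (P1 + 2 w P2). *)
have -> : \sum_i \sum_j
    (P1 (sqdist z y) * (2 * (y - z) ord0 i) +
     Q1 (sqdist y y) * (2 * (y - y) ord0 i)) *
    (P1 (sqdist z y) * (2 * (y - z) ord0 j) +
     Q1 (sqdist y y) * (2 * (y - y) ord0 j)) *
    (P1 (sqdist z y) * (2 * (i == j)%:R) +
     2 * (y - z) ord0 j * (P2 (sqdist z y) * (2 * (y - z) ord0 i)) +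
     (Q1 (sqdist y y) * (2 * (i == j)%:R) +
      2 * (y - y) ord0 j * (Q2 (sqdist y y) * (2 * (y - y) ord0 i)))) =
    8 * (P1 w ^+ 2 * w * (P1 w + 2 * w * P2 w)).
  rewrite yy /Q1 mulr0 -hw.
  pose d i := (y - z) ord0 i.
  have wE : w = \sum_i d i * d i by rewrite hw.
  transitivity (\sum_i (8 * P1 w ^+ 3 * (d i * d i) +
      16 * P1 w ^+ 2 * P2 w * w * (d i * d i))).
    apply: eq_bigr => i _.
    transitivity (\sum_j (8 * P1 w ^+ 3 * (d i * d j) * (i == j)%:R +
      16 * P1 w ^+ 2 * P2 w * (d i * d i) * (d j * d j))).
      apply: eq_bigr => j _; rewrite subrr !mxE /d !mxE; ring.
    rewrite big_split/= -mulr_sumr -wE (bigD1 i)//= eqxx mulr1 big1 => [|j ji].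
      by ring.
    by rewrite eq_sym (negbTE ji) mulr0.
  rewrite big_split/= -!mulr_sumr -wE; ring.
by rewrite pmulr_rge0.
Qed.

(** If the inequality failed by m at some point, v minus a slightly perturbed cone would attain its
    maximum over the closure at a point of V away from the vertex, where the perturbed cone violates
    the inequality of [radial_touch]. *)
Lemma cone_comparison D V v z (a b M : R) :
  bounded_set D -> (forall x, D x -> v x <= M) -> inf_subharmonic D v ->
  open V -> V `<=` D -> ~ V z -> {within closure V, continuous v} -> 0 < b ->
  (forall x, closure V x -> ~ V x -> v x <= a + b * enorm (x - z)) ->
  forall x, V x -> v x <= a + b * enorm (x - z).
Proof.
move=> bD vM subv oV VD Vz cv b0 bdry x1 Vx1; rewrite leNgt; apply/negP => lt1.
pose m : R := v x1 - (a + b * enorm (x1 - z)).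
have m0 : 0 < m by rewrite subr_gt0.
have bV : bounded_set V.
  move: bD => /bounded_enormP[W W0 hW]; apply/bounded_enormP.
  by exists W => // x /VD; exact: hW.
have [W W0 hW] : exists2 W : R, 0 < W & forall x, closure D x -> sqdist z x <= W.
  have /bounded_enormP[W W0 hW] := bounded_closure bD.
  exists ((W + enorm z) ^+ 2) => [|x /hW xW].
    by rewrite exprn_gt0// ltr_wpDr// enorm_ge0.
  rewrite sqdistE ler_sqr ?nnegrE ?enorm_ge0//; last first.
    by rewrite addr_ge0 ?enorm_ge0// ltW.
  by rewrite (le_trans (ler_enormD _ _))// enormN lerD2r.
have VDc : closure V `<=` closure D by exact: closureS.
(* Near the vertex the barrier is not a strict supersolution, so the maximum has to be kept at
   distance r from z; continuity and the hypothesis at z itself, when z is in the closure, provide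
   this. *)
have [r r0 hr] : exists2 r : R, 0 < r & forall x, closure V x ->
    enorm (x - z) < r -> v x <= a + m / 4.
  have [cVz|cVz] := pselect (closure V z); last first.
    have : open (~` closure V) by rewrite openC; exact: closed_closure.
    by move=> /openP/(_ _ cVz)[r r0 hr]; exists r => // x Vx /hr.
  have /within_continuousP/(_ _ cVz (m / 4)) [|r r0 hr] := cv.
    by rewrite divr_gt0.
  exists r => // x Vx xr; have := hr x Vx xr.
  have := bdry z cVz Vz; rewrite subrr enorm0 mulr0 addr0 => h1.
  rewrite ltr_norml => /andP[_ h2]; rewrite -lerBlDl; apply/ltW.
  by apply: le_lt_trans h2; rewrite lerB.
pose s1 := Num.sqrt (W + 1).
have s10 : 0 < s1 by rewrite sqrtr_gt0 addr_gt0.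
(* The first bound keeps the quadratic term below m/4. The second makes the profile increasing, [P1]
   > 0, because the smoothed distance is at most [s1]. *)
pose eps : R := Num.min (m / (4 * W)) (b / (4 * s1)).
have eps0 : 0 < eps by rewrite lt_min !divr_gt0 ?mulr_gt0.
have epsW : eps * W <= m / 4.
  rewrite (@le_trans _ _ (m / (4 * W) * W))//.
    by rewrite ler_wpM2r ?(ltW W0)// ge_min lexx.
  by rewrite invfM !mulrA mulfVK// gt_eqF.
have epsb : eps < b / (2 * s1).
  rewrite (@le_lt_trans _ _ (b / (4 * s1)))//.
    by rewrite ge_min lexx orbT.
  by rewrite ltr_pM2l// ltf_pV2 ?posrE ?mulr_gt0// ltr_pM2r// ltr_nat.
(* The three bounds on the smoothing scale: t <= 1 gives s <= [s1]; b t <= m/4 bounds the smoothing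
   error; b t <= eps r^3 makes b t^2 / (2 s^3) - eps negative for s >= r. *)
pose t : R := Num.min 1 (Num.min (m / (4 * b)) (eps * r ^+ 3 / b)).
have t0 : 0 < t by rewrite !lt_min ltr01/= !divr_gt0 ?mulr_gt0 ?exprn_gt0.
have t1 : t <= 1 by rewrite ge_min lexx.
have tm : b * t <= m / 4.
  rewrite mulrC -ler_pdivlMr// (@le_trans _ _ (m / (4 * b)))//.
    by rewrite !ge_min lexx orbT.
  by rewrite invfM mulrA.
have tr : b * t <= eps * r ^+ 3.
  by rewrite mulrC -ler_pdivlMr// !ge_min lexx !orbT.
(* The barrier a + b sqrt(|x-z|^2 + t^2) - eps |x-z|^2 is a smooth perturbation of
   the cone whose infinity Laplacian is negative for |x - z| >= r. *)
pose S (w : R) : R := Num.sqrt (w + t ^+ 2).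
have S0 (w : R) : 0 <= w -> 0 < S w.
  by move=> w0; rewrite sqrtr_gt0 ltr_wpDl// exprn_gt0.
have SE (w : R) : 0 <= w -> S w ^+ 2 = w + t ^+ 2.
  by move=> w0; rewrite sqr_sqrtr// addr_ge0// sqr_ge0.
pose P (w : R) : R := a + (b * S w - eps * w).
pose P1 (w : R) : R := b / 2 * (S w)^-1 - eps.
pose P2 (w : R) : R := - (b / 4) * (S w) ^- 3.
have dS (w : R) : 0 <= w -> is_derive w 1 S (2 * S w)^-1.
  move=> w0; have h : is_derive w 1 (fun u : R => u + t ^+ 2) 1.
    by apply: is_derive_eq; rewrite addr0.
  rewrite -[(2 * S w)^-1]mulr1.
  apply: (@is_derive1_comp _ Num.sqrt (fun u : R => u + t ^+ 2)).
  by apply: is_derive1_sqrt; rewrite ltr_wpDl// exprn_gt0.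
have dP (w : R) : 0 <= w -> is_derive w 1 P (P1 w).
  move=> w0; have h := dS _ w0; apply: is_derive_eq.
  rewrite /P1 add0r [eps%:A]mulr1 -[b *: _]/(b * _) invfM !mulrA; ring.
have dP1 (w : R) : 0 <= w -> is_derive w 1 P1 (P2 w).
  move=> w0; have h := dS _ w0; have Sn0 : S w != 0 by rewrite gt_eqF// S0.
  have hV := is_deriveV Sn0 h; apply: is_derive_eq; rewrite /P2 subr0.
  rewrite -[_ *: (_ *: _)]/(b / 2 * (_ * _)); field.
  exact: Sn0.
have cP2 (w : R) : 0 <= w -> {for w, continuous P2}.
  move=> w0; have cS : {for w, continuous S}.
    by apply: differentiable_continuous; apply/derivable1_diffP; case: (dS _ w0).
  apply: continuousM; first exact: cst_continuous.
  apply: (@continuousV _ _ (fun w => S w ^+ 3)); first by rewrite gt_eqF// exprn_gt0// S0.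
  exact: (@continuous_comp _ _ _ S (fun u : R => u ^+ 3) w cS (@exprn_continuous _ 3 _)).
have cP : continuous (fun x => P (sqdist z x)).
  by have [] := C2_data_radial z dP dP1 cP2.
have [y cVy ymax] : exists2 y, closure V y & forall x, closure V x ->
    v x - P (sqdist z x) <= v y - P (sqdist z y).
  have [|||y cVy h] := @compact_EVT_max 'rV[R]_N R
      (fun x => v x - P (sqdist z x)) (closure V).
  - by exists x1; exact: subset_closure.
  - exact: compact_closure.
  - have /subspace_continuousP cv' := cv.
    apply/subspace_continuousP => x Vx; apply: cvgB; first exact: cv'.
    by apply: cvg_within_filter; exact: cP.
  - by exists y; [rewrite -inE|move=> x Vx; apply: h; rewrite inE].
have [Sge Sle] : (forall x, enorm (x - z) <= S (sqdist z x)) /\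
    (forall x, S (sqdist z x) <= enorm (x - z) + t).
  split=> x.
    rewrite -ler_sqr ?nnegrE ?enorm_ge0 ?sqrtr_ge0// SE ?sqdist_ge0//.
    by rewrite sqdistE lerDl sqr_ge0.
  rewrite -ler_sqr ?nnegrE ?sqrtr_ge0 ?addr_ge0 ?enorm_ge0// ?(ltW t0)//.
  rewrite SE ?sqdist_ge0// sqdistE sqrrD -addrA lerD2l lerDr.
  by rewrite mulrn_wge0// mulr_ge0 ?enorm_ge0// ltW.
have Pge x : closure D x -> a + b * enorm (x - z) - m / 4 <= P (sqdist z x).
  move=> Dx; rewrite /P -addrA lerD2l lerB//.
    by rewrite ler_pM2l.
  by apply: le_trans epsW; rewrite ler_pM2l// hW.
(* This beats m/4, the bound on v - P at points of the closure outside V, and m/2, the bound within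
   r of z. *)
have big : 3 * m / 4 <= v y - P (sqdist z y).
  apply: le_trans (ymax x1 (subset_closure Vx1)).
  have := Sle x1; rewrite -(ler_pM2l b0) mulrDr /P /m => h.
  have := mulr_ge0 (ltW eps0) (sqdist_ge0 z x1); have := tm; rewrite /m; lra.
have Vy : V y.
  apply: contrapT => nVy; have := bdry _ cVy nVy; have := Pge _ (VDc _ cVy); lra.
have ry : r <= enorm (y - z).
  rewrite leNgt; apply/negP => ry; have := hr _ cVy ry.
  have := Pge _ (VDc _ cVy).
  have := mulr_ge0 (ltW b0) (enorm_ge0 (y - z)); lra.
have [e e0 he] : exists2 e : R, 0 < e & forall x, enorm (x - y) < e -> V x.
  by move/openP : oV; apply.
have M' x : D x -> v x - P (sqdist z x) <= M - a + eps * W.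
  move=> Dx; have := vM _ Dx; have := mulr_ge0 (ltW b0) (sqrtr_ge0 (sqdist z x + t ^+ 2)).
  have := hW _ (subset_closure Dx); rewrite -(ler_pM2l eps0) /P /S; lra.
have locmax x : D x -> enorm (x - y) < e ->
    v x - P (sqdist z x) <= v y - P (sqdist z y).
  by move=> _ /he Vx; apply: ymax; exact: subset_closure.
have := radial_touch dP dP1 cP2 subv (VD _ Vy) M' e0 locmax erefl.
rewrite leNgt => /negP; apply.
set w := sqdist z y; have w0 : 0 <= w by exact: sqdist_ge0.
set s := S w; have s0 : 0 < s by exact: S0.
have wr : r ^+ 2 <= w.
  by rewrite /w sqdistE ler_sqr ?nnegrE ?enorm_ge0// ltW.
have wpos : 0 < w by apply: lt_le_trans wr; rewrite exprn_gt0.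
have rs : r <= s.
  rewrite -ler_sqr ?nnegrE ?(ltW r0) ?(ltW s0)// SE//.
  by apply: (le_trans wr); rewrite lerDl sqr_ge0.
have ss1 : s <= s1.
  rewrite /s /S /s1 ler_sqrt; last by rewrite addr_ge0// ltW.
  by apply: lerD; [exact: hW (VDc _ cVy)|rewrite expr_le1// ltW].
have P10 : 0 < P1 w.
  rewrite /P1 subr_gt0 -/s (lt_le_trans epsb)// -mulrA -invfM.
  by rewrite ler_pM2l// lef_pV2 ?posrE ?mulr_gt0// ler_pM2l.
rewrite pmulr_rlt0; last by rewrite mulr_gt0// exprn_gt0.
have -> : P1 w + 2 * w * P2 w = b * t ^+ 2 / (2 * s ^+ 3) - eps.
  rewrite /P1 /P2 -/s (_ : w = s ^+ 2 - t ^+ 2); last by rewrite SE// addrK.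
  by field; rewrite gt_eqF.
rewrite subr_lt0 ltr_pdivrMr ?mulr_gt0 ?exprn_gt0//.
apply: (@le_lt_trans _ _ (eps * s ^+ 3)).
  apply: (@le_trans _ _ (b * t)); first by rewrite ler_pM2l// expr2 ler_piMl// ltW.
  by apply: (le_trans tr); rewrite ler_pM2l// lerXn2r// ?nnegrE ?(ltW r0)// (ltW s0).
by rewrite ltr_pM2l// ltr_pMl ?exprn_gt0// ltr1n.
Qed.

End cone_comparison.

(** * The Dirichlet solution *)

(** Real induction: the supremum of the initial intervals on which P holds is the exit time. P fails
    at that time itself, since otherwise it would extend to the right. *)
Lemma first_exit {R : realType} (P : R -> Prop) (T : R) :
  0 <= T -> ~ P T ->
  (forall t, 0 <= t -> (forall s, 0 <= s < t -> P s) -> P t ->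
     exists2 e : R, 0 < e & forall s, t <= s < t + e -> P s) ->
  exists2 t : R, 0 <= t <= T & (forall s, 0 <= s < t -> P s) /\ ~ P t.
Proof.
move=> T0 nPT ext; apply: contrapT => nex.
pose S := [set t : R | 0 <= t <= T /\ forall s, 0 <= s < t -> P s].
have S0 : S 0.
  by split; [rewrite lexx|move=> s /andP[s0 /lt_geF]; rewrite s0].
have hS : has_sup S by split; [exists 0|exists T => t [/andP[]]].
have St0 : 0 <= sup S <= T.
  apply/andP; split; first exact: (ub_le_sup hS.2).
  by apply: (ge_sup hS.1) => t [/andP[]].
have SP s : 0 <= s < sup S -> P s.
  move=> /andP[s0 sS]; have [t [tT tP] st] := sup_gt hS.1 sS.
  by apply: tP; rewrite s0.
have Pt : P (sup S).
  by apply: contrapT => nP; apply: nex; exists (sup S).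
have [e e0 he] := ext _ (andP St0).1 SP Pt.
have PS s : 0 <= s < sup S + e -> P s.
  move=> /andP[s0 se]; have [sS|Ss] := ltP s (sup S); first by apply: SP; rewrite s0.
  by apply: he; rewrite Ss.
have Te : sup S + e <= T.
  by rewrite leNgt; apply/negP => Te; apply: nPT; apply: PS; rewrite T0.
have : S (sup S + e).
  by split=> //; rewrite Te andbT addr_ge0 ?(andP St0).1// ltW.
by move=> /(ub_le_sup hS.2); rewrite leNgt ltrDl e0.
Qed.

(** * Segments that leave an open set *)

Section boundary_geometry.
Context {R : realType} {N : nat}.
Implicit Types (x y z : 'rV[R]_N) (Om : set 'rV[R]_N).

Lemma open_line Om x d (t : R) : open Om -> Om (x + t *: d) ->
  exists2 e : R, 0 < e & forall s, `|s - t| < e -> Om (x + s *: d).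
Proof.
move=> /openP oO /oO[r r0 hr]; have [e e0 he] := near_line x d t r0.
by exists e => // s /he; exact: hr.
Qed.

Lemma limit_line (A : set 'rV[R]_N) x d (t : R) : 0 < t ->
  (forall s, 0 <= s < t -> A (x + s *: d)) -> closure A (x + t *: d).
Proof.
move=> t0 hA; apply/closure_enormP => r r0.
have [e e0 he] := near_line x d t r0.
pose s := Num.max 0 (t - e / 2).
have st : s < t by rewrite gt_max t0/= ltrBlDr ltrDl divr_gt0.
exists (x + s *: d); first by apply: hA; rewrite st andbT le_max lexx.
apply: he; rewrite distrC gtr0_norm ?subr_gt0// ltrBlDr -ltrBlDl.
by rewrite lt_max ltrD2l ltrN2 ltr_pdivrMr// ltr_pMr// ltr1n orbT.
Qed.

Lemma open_boundary Om x : open Om ->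
  Defs.boundary Om x <-> closure Om x /\ ~ Om x.
Proof. by move=> /interior_id; rewrite /Defs.boundary => ->. Qed.

Lemma segment_boundary Om x d (T : R) : open Om -> Om x -> 0 <= T ->
  ~ Om (x + T *: d) ->
  exists2 t : R, 0 < t <= T & Defs.boundary Om (x + t *: d).
Proof.
move=> oO Ox T0 nO.
have [t tT [hs nt]] : exists2 t : R, 0 <= t <= T &
    (forall s : R, 0 <= s < t -> Om (x + s *: d)) /\ ~ Om (x + t *: d).
  apply: (@first_exit R (fun t => Om (x + t *: d))) => // t t0 _ Ot.
  have [e e0 he] := open_line oO Ot; exists e => // s /andP[ts se].
  by apply: he; rewrite ger0_norm ?subr_ge0// ltrBlDl.
have t0 : 0 < t.
  rewrite lt_neqAle (andP tT).1 andbT; apply/eqP => t0.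
  by apply: nt; rewrite -t0 scale0r addr0.
exists t; first by rewrite t0 (andP tT).2.
by apply/open_boundary => //; split=> //; exact: limit_line.
Qed.

End boundary_geometry.

Section dirichlet.
Context {R : realType} {N : nat} (Om : set 'rV[R]_N) (x0 : 'rV[R]_N).
Variable u : 'rV[R]_N -> R.
Hypotheses (N0 : (0 < N)%N) (dom : is_domain Om) (bOm : bounded_set Om).
Hypotheses (Ox0 : Om x0) (hu : dirichlet_solution Om x0 u).
Implicit Types (x y z : 'rV[R]_N).

Let oO : open Om. Proof. by case: dom. Qed.

Let D := Om `\ x0.

Lemma open_punctured : open D.
Proof.
rewrite /D setDE; apply: openI => //; exact: open_setC1.
Qed.

Lemma dirichlet_cont : {within closure Om, continuous u}.
Proof. by case: hu. Qed.

Lemma dirichlet_bdry y : Defs.boundary Om y -> u y = 0.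
Proof. by case: hu => _ _ + _; exact. Qed.

Lemma dirichlet_x0 : u x0 = 1.
Proof. by case: hu. Qed.

(* Both u and -u are infinity-subharmonic off x0; the boolean lets each comparison
   be made once. *)
Definition signed (c : bool) x : R := if c then u x else - u x.

Lemma signed_cont c : {within closure Om, continuous signed c}.
Proof.
case: c => //=; first exact: dirichlet_cont.
have /subspace_continuousP cu := dirichlet_cont.
by apply/subspace_continuousP => x Ox; apply: cvgN; exact: cu.
Qed.

Lemma signed_sub c : inf_subharmonic D (signed c).
Proof.
case: hu => _ hD _ _; case: c; first exact: inf_harmonic_sub.
exact: inf_harmonic_subN.
Qed.

Lemma signed_bounded c : exists M, forall x, closure Om x -> signed c x <= M.
Proof.
have [||| y _ h] := @compact_EVT_max 'rV[R]_N R (signed c) (closure Om).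
- by exists x0; exact: subset_closure.
- exact: compact_closure.
- exact: signed_cont.
- by exists (signed c y) => x Ox; apply: h; rewrite inE.
Qed.

Lemma signed_cone c V z (a b : R) : open V -> V `<=` D -> ~ V z -> 0 < b ->
  (forall x, closure V x -> ~ V x -> signed c x <= a + b * enorm (x - z)) ->
  forall x, V x -> signed c x <= a + b * enorm (x - z).
Proof.
move=> oV VD Vz b0 bdry.
have [M hM] := signed_bounded c.
have DO : D `<=` Om by move=> x [].
have bD : bounded_set D.
  move: bOm => /bounded_enormP[W W0 hW]; apply/bounded_enormP.
  by exists W => // x /DO; exact: hW.
apply: (@cone_comparison _ _ D V (signed c) z a b M) => //.
- by move=> x /DO Ox; apply: hM; exact: subset_closure.
- exact: signed_sub.
- apply: continuous_subspaceW (signed_cont (c := c)).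
  by apply: closureS; exact: subset_trans DO.
Qed.

(** Removing x0 and z from the domain turns both into points outside the set of comparison, so that
    besides the boundary only the values at these two points need checking. The condition at z is
    conditional because z may be a boundary point. *)
Lemma signed_global_cone c z (a b : R) : 0 < b ->
  (forall x, Defs.boundary Om x -> signed c x <= a + b * enorm (x - z)) ->
  signed c x0 <= a + b * enorm (x0 - z) -> (Om z -> signed c z <= a) ->
  forall x, Om x -> signed c x <= a + b * enorm (x - z).
Proof.
move=> b0 hbd hx0 hz x Ox.
have [->//|xx0] := eqVneq x x0.
have [xz|xz] := eqVneq x z.
  by rewrite xz subrr enorm0 mulr0 addr0; apply: hz; rewrite -xz.
pose V := D `\ z.
have oV : open V.
  rewrite /V setDE; apply: openI; first exact: open_punctured.
  exact: open_setC1.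
apply: (@signed_cone c V) => //.
- by move=> y [].
- by move=> [_]; apply.
- move=> y cy nVy.
  have [->//|yx0] := eqVneq y x0.
  have cO : closure Om y by apply: closureS cy => w [[]].
  have [Oy|nOy] := pselect (Om y); last by apply: hbd; apply/open_boundary.
  have [yz|yz] := eqVneq y z.
    by move: Oy; rewrite yz subrr enorm0 mulr0 addr0; exact: hz.
  by exfalso; apply: nVy; split; [split=> //|]; exact/eqP.
- by split; [split=> //|]; exact/eqP.
Qed.

(** Comparison requires a positive slope; comparison with a constant is recovered by letting the
    slope tend to 0. *)
Lemma le_of_cones (A B C : R) : 0 <= C -> (forall b, 0 < b -> A <= B + b * C) ->
  A <= B.
Proof.
move=> C0 h; rewrite leNgt; apply/negP => BA.
have C1 : 0 < C + 1 by rewrite ltr_wpDl.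
have := h ((A - B) / (C + 1)); rewrite divr_gt0 ?subr_gt0// => /(_ isT).
rewrite -lerBlDl leNgt => /negP; apply.
rewrite mulrAC ltr_pdivrMr// ltr_pM2l ?subr_gt0//.
by rewrite ltrDl.
Qed.

Lemma dirichlet_le1 x : closure Om x -> u x <= 1.
Proof.
move=> cO; have [Ox|nO] := pselect (Om x); last first.
  by rewrite dirichlet_bdry//; apply/open_boundary.
apply: (@le_of_cones _ _ (enorm (x - x0))); first exact: enorm_ge0.
move=> b b0; apply: (@signed_global_cone true x0) => //=.
- move=> y /dirichlet_bdry ->; rewrite addr_ge0// mulr_ge0 ?enorm_ge0//.
  exact: ltW.
- by rewrite dirichlet_x0 lerDl mulr_ge0 ?enorm_ge0// ltW.
- by rewrite dirichlet_x0.
Qed.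

Lemma dirichlet_ge0 x : closure Om x -> 0 <= u x.
Proof.
move=> cO; have [Ox|nO] := pselect (Om x); last first.
  by rewrite dirichlet_bdry//; apply/open_boundary.
rewrite -oppr_le0.
apply: (@le_of_cones _ _ (enorm (x - x0))); first exact: enorm_ge0.
move=> b b0; apply: (@signed_global_cone false x0) => //=.
- move=> y /dirichlet_bdry ->; rewrite oppr0 addr_ge0// mulr_ge0 ?enorm_ge0//.
  exact: ltW.
- rewrite dirichlet_x0 (le_trans (lerN10 _))// addr_ge0//.
  by rewrite mulr_ge0 ?enorm_ge0// ltW.
- by rewrite dirichlet_x0 lerN10.
Qed.

(** The cone with vertex y that takes the value m on the sphere of radius r lies above the function
    on the punctured ball, and it is below m inside. *)
Lemma signed_ball c y (r m : R) : 0 < r ->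
  (forall x, enorm (x - y) < r -> D x) ->
  (forall x, closure Om x -> signed c x <= m) -> signed c y < m ->
  forall x, enorm (x - y) < r -> signed c x < m.
Proof.
move=> r0 hr hm ym x xr.
have [->//|xy] := eqVneq x y.
pose b := (m - signed c y) / r.
have b0 : 0 < b by rewrite divr_gt0// subr_gt0.
pose V := [set x | enorm (x - y) < r] `\ y.
have oB : open [set x | enorm (x - y) < r].
  apply/openP => w /= wr; exists (r - enorm (w - y)) => [|v]; first by rewrite subr_gt0.
  by rewrite ltrBrDr; apply: le_lt_trans; exact: ler_enorm_dist.
have oV : open V.
  rewrite /V setDE; apply: openI => //.
  exact: open_setC1.
have VD : V `<=` D by move=> w [/hr].
have -> : m = signed c y + b * r by rewrite /b mulfVK ?gt_eqF// subrKC.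
apply: (@le_lt_trans _ _ (signed c y + b * enorm (x - y))); last first.
  by rewrite ltrD2l ltr_pM2l.
apply: (@signed_cone c V) => //.
- by move=> [_]; apply.
- move=> w cw nVw.
  have [->|wy] := eqVneq w y; first by rewrite subrr enorm0 mulr0 addr0.
  have rw : r <= enorm (w - y).
    rewrite leNgt; apply/negP => wr; apply: nVw; split=> //; exact/eqP.
  apply: (@le_trans _ _ m).
    by apply: hm; apply: closureS cw => v /VD[].
  rewrite -lerBlDl (_ : m - _ = b * r) ?ler_pM2l//.
  by rewrite /b mulfVK ?gt_eqF.
- by split=> //; exact/eqP.
Qed.

(** A point y near x with a smaller value would be the centre of a ball of radius r/2 that contains
    x and stays in [D]; [signed_ball] would then give a value below m at x. *)
Lemma signed_max_propagates c (m : R) x :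
  (forall x, closure Om x -> signed c x <= m) -> D x -> signed c x = m ->
  exists2 r : R, 0 < r & forall y, enorm (y - x) < r -> signed c y = m /\ D y.
Proof.
move=> hm Dx xm; have [r r0 hr] := (openP D).1 open_punctured _ Dx.
exists (r / 2) => [|y yx]; first by rewrite divr_gt0.
have rr : r / 2 < r by rewrite ltr_pdivrMr// ltr_pMr// ltr1n.
have Dy : D y by apply: hr; exact: lt_trans rr.
split=> //; apply/eqP; rewrite eq_le hm/=; last first.
  by case: Dy => Oy _; exact: subset_closure.
rewrite leNgt; apply/negP => ym.
have := @signed_ball c y (r / 2) m; rewrite divr_gt0// => /(_ isT).
move=> /(_ _ hm ym x); rewrite xm ltxx enormB => H; suff: false by [].
apply: H => // w wy; apply: hr.
by rewrite (le_lt_trans (ler_enorm_dist _ _ y))// (splitr r) ltrD.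
Qed.

Lemma unbounded_line d x : d != 0 -> exists2 T : R, 0 <= T & ~ Om (x + T *: d).
Proof.
move=> d0; have [M M0 hM] := (bounded_enormP Om).1 bOm.
have ed : 0 < enorm d by rewrite enorm_gt0.
have T0 : 0 <= (M + enorm x + 1) / enorm d.
  by rewrite divr_ge0 ?enorm_ge0// !addr_ge0 ?enorm_ge0// ltW.
exists ((M + enorm x + 1) / enorm d) => // /hM.
have := ler_enormD (x + (M + enorm x + 1) / enorm d *: d) (- x).
rewrite addrAC subrr add0r enormZ ger0_norm// mulfVK ?gt_eqF// enormN; lra.
Qed.

(* The value 1 would propagate from x1 to the boundary along the ray from x0
   through x1, which does not meet x0 again. *)
Lemma dirichlet_lt1 x1 : D x1 -> u x1 < 1.
Proof.
move=> [Ox1 x10]; have /eqP x1x0 := x10.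
rewrite lt_neqAle dirichlet_le1 ?andbT; last exact: subset_closure.
apply/eqP => ux1; pose d := x1 - x0.
have d0 : d != 0 by rewrite subr_eq0.
have [T T0 nOT] := unbounded_line x1 d0.
pose P (t : R) := u (x1 + t *: d) = 1 /\ D (x1 + t *: d).
have [||t tT [hs nP]] := @first_exit R P T T0.
- by move=> [_ [/nOT]].
- move=> t t0 _ [ut Dt].
  have [] := @signed_max_propagates true 1 _ _ Dt ut.
    by move=> x; exact: dirichlet_le1.
  move=> r r0 hr; have [e e0 he] := near_line x1 d t r0.
  exists e => // s /andP[ts se]; apply: hr; apply: he.
  by rewrite ger0_norm ?subr_ge0// ltrBlDl.
have P0 : P 0 by split; rewrite scale0r addr0.
have t0 : 0 < t.
  by rewrite lt_neqAle (andP tT).1 andbT; apply/eqP => t0; apply: nP; rewrite -t0.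
have cl : closure Om (x1 + t *: d).
  by apply: limit_line => // s /hs[_ []].
have ut : u (x1 + t *: d) = 1.
  apply/eqP; rewrite eq_le dirichlet_le1//= leNgt; apply/negP => lt1.
  have /within_continuousP/(_ _ cl) := dirichlet_cont.
  move=> /(_ (1 - u (x1 + t *: d))); rewrite subr_gt0 => /(_ lt1)[r r0 hr].
  have /closure_enormP/(_ r r0)[y [s ss <-] ys] :
      closure [set x1 + s *: d | s in [set s | 0 <= s < t]] (x1 + t *: d).
    by apply: limit_line => // s ss; exists s.
  have [us [Os _]] := hs _ ss.
  have := hr _ (subset_closure Os) ys; rewrite us.
  by rewrite gtr0_norm ?subr_gt0// ltxx.
have [Ot|nOt] := pselect (Om (x1 + t *: d)).
  apply: nP; split=> //; split=> // xt.
  have : (1 + t) *: d = 0 by rewrite scalerDl scale1r {1}/d addrAC xt subrr.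
  by move=> /eqP; rewrite scaler_eq0 (negbTE d0) orbF gt_eqF// addr_gt0.
have := @dirichlet_bdry (x1 + t *: d); rewrite ut => h.
suff /eqP : (1 : R) = 0 by rewrite oner_eq0.
by apply: h; apply/open_boundary.
Qed.

Lemma dirichlet_gt0 x1 : Om x1 -> 0 < u x1.
Proof.
move=> Ox1; rewrite lt_neqAle dirichlet_ge0 ?andbT; last exact: subset_closure.
apply/eqP => ux1.
pose Z := [set x | Om x /\ u x = 0].
have : Z = Om.
  case: dom => _ _ cO; apply: cO.
  - by exists x1; split.
  - exists Z; last by apply/seteqP; split=> [x [Ox ux]//|x []].
    apply/openP => x [Ox ux].
    have xx0 : x != x0.
      by apply/eqP => xx0; move/eqP: ux; rewrite xx0 dirichlet_x0 oner_eq0.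
    have [] := @signed_max_propagates false 0 x.
    + by move=> y /dirichlet_ge0; rewrite /= oppr_le0.
    + by split=> //; exact/eqP.
    + by rewrite /= ux oppr0.
    move=> r r0 hr; exists r => // y /hr[/eqP]; rewrite oppr_eq0 => /eqP uy [Oy _].
    by split.
  - exists (closure Z); first exact: closed_closure.
    apply/seteqP; split=> [x [Ox ux]|x [Ox cx]].
      by split=> //; apply: subset_closure.
    split=> //; apply/eqP; rewrite eq_le dirichlet_ge0 ?andbT; last exact: subset_closure.
    rewrite leNgt; apply/negP => ux.
    have /within_continuousP/(_ _ (subset_closure Ox) _ ux)[r r0 hr] := dirichlet_cont.
    have /closure_enormP/(_ r r0)[y [Oy uy] yx] := cx.
    have := hr y (subset_closure Oy) yx.
    by rewrite uy sub0r normrN gtr0_norm// ltxx.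
move=> ZO; have [_] : Z x0 by rewrite ZO.
by move=> /eqP; rewrite dirichlet_x0 oner_eq0.
Qed.

Let L := (dist_boundary Om x0)^-1.

Lemma boundary_neq0 : exists y, Defs.boundary Om y.
Proof.
have d0 : Defs.basis (Ordinal N0) != 0 :> 'rV[R]_N.
  apply/eqP => /rowP/(_ (Ordinal N0)); rewrite !mxE !eqxx => /eqP.
  by rewrite oner_eq0.
have [T T0 nO] := unbounded_line x0 d0.
by have [t _ hb] := segment_boundary oO Ox0 T0 nO; exists (x0 + t *: Defs.basis (Ordinal N0)).
Qed.

Lemma dist_boundary_le x y : Defs.boundary Om y ->
  dist_boundary Om x <= enorm (y - x).
Proof.
move=> hy; apply: ge_inf; last by exists y.
by exists 0 => _ [w _ <-]; exact: enorm_ge0.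
Qed.

Lemma dist_boundary_adherent x (e : R) : 0 < e -> exists2 y,
  Defs.boundary Om y & enorm (y - x) < dist_boundary Om x + e.
Proof.
move=> e0; have [y0 hy0] := boundary_neq0.
have hinf : has_inf [set enorm (y - x) | y in Defs.boundary Om].
  split; first by exists (enorm (y0 - x)), y0.
  by exists 0 => _ [w _ <-]; exact: enorm_ge0.
by have [_ [y hy <-] ye] := inf_adherent e0 hinf; exists y.
Qed.

Lemma le_dist_boundary x (a : R) :
  (forall y, Defs.boundary Om y -> a <= enorm (y - x)) -> a <= dist_boundary Om x.
Proof.
move=> h; have [y0 hy0] := boundary_neq0.
by apply: lb_le_inf; [exists (enorm (y0 - x)), y0|move=> _ [y hy <-]; exact: h].
Qed.

Lemma dist_boundary_gt0 x : Om x -> 0 < dist_boundary Om x.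
Proof.
move=> Ox; have [r r0 hr] := (openP Om).1 oO _ Ox.
apply: (lt_le_trans r0); apply: le_dist_boundary => y.
move=> /(open_boundary _ oO)[_ nO]; rewrite leNgt; apply/negP => yr.
by apply: nO; exact: hr.
Qed.

Lemma dist_boundary_ball x y : Om x -> enorm (y - x) < dist_boundary Om x -> Om y.
Proof.
move=> Ox xy; apply: contrapT => nOy.
have nO : ~ Om (x + (1 : R) *: (y - x)) by rewrite scale1r addrC subrK.
have [t /andP[t0 t1] ht] := segment_boundary oO Ox ler01 nO.
have := dist_boundary_le x ht; rewrite leNgt => /negP; apply.
rewrite addrAC subrr add0r enormZ gtr0_norm//.
by apply: le_lt_trans xy; rewrite ler_piMl// enorm_ge0.
Qed.

Lemma dist_boundary_lip x y :
  dist_boundary Om x - enorm (y - x) <= dist_boundary Om y.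
Proof.
apply: le_dist_boundary => w hw; rewrite lerBlDr.
exact: (le_trans (dist_boundary_le x hw)) (ler_enorm_dist _ _ _).
Qed.

Let L0 : 0 < L. Proof. by rewrite invr_gt0 dist_boundary_gt0. Qed.

(** This is where the slope comes from: boundary points are at distance at least 1 / L from x0, so
    the cone is nonpositive there. *)
Lemma dirichlet_cone_x0 x : Om x -> 1 - L * enorm (x - x0) <= u x.
Proof.
move=> Ox.
suff : - u x <= - 1 + L * enorm (x - x0) by lra.
apply: (@signed_global_cone false x0) => //=.
- move=> y hy; rewrite dirichlet_bdry// oppr0 addrC subr_ge0 -ler_pdivrMl//.
  by rewrite mulr1 invrK; exact: dist_boundary_le.
- by rewrite dirichlet_x0 subrr enorm0 mulr0 addr0.
- by rewrite dirichlet_x0.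
Qed.

Lemma dirichlet_cone_bdry y x : Defs.boundary Om y -> Om x ->
  u x <= L * enorm (x - y).
Proof.
move=> hy Ox; rewrite -[leRHS]add0r.
apply: (@signed_global_cone true y) => //=.
- by move=> w /dirichlet_bdry ->; rewrite add0r mulr_ge0 ?enorm_ge0// ltW.
- rewrite dirichlet_x0 add0r -ler_pdivrMl// mulr1 invrK enormB.
  exact: dist_boundary_le.
- by move: hy => /(open_boundary _ oO)[].
Qed.

(** The cone at z is nonnegative on the boundary, and at x0 it is at least 1 by [dirichlet_cone_x0]
    applied at z. *)
Lemma dirichlet_lip x z : Om x -> Om z -> u x <= u z + L * enorm (x - z).
Proof.
move=> Ox Oz.
have u0 y : Om y -> 0 <= u y by move=> Oy; apply: dirichlet_ge0; exact: subset_closure.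
apply: (@signed_global_cone true z) => //=.
- move=> w /dirichlet_bdry ->; rewrite addr_ge0 ?u0//.
  by rewrite mulr_ge0 ?enorm_ge0// ltW.
- by rewrite dirichlet_x0 enormB; have := dirichlet_cone_x0 Oz; lra.
Qed.

Definition extension x : R := if pselect (Om x) then u x else 0.

Lemma extensionE x : Om x -> extension x = u x.
Proof. by rewrite /extension; case: pselect. Qed.

Lemma extension_out x : ~ Om x -> extension x = 0.
Proof. by rewrite /extension; case: pselect. Qed.

(** When only one point lies in [Om], the segment between them meets the boundary no farther away
    than the other point, and the cone at that boundary point gives the bound. *)
Lemma extension_lip x y : `|extension x - extension y| <= L * enorm (x - y).
Proof.
have out a b : Om a -> ~ Om b -> `|extension a - extension b| <= L * enorm (a - b).
  move=> Oa nOb; rewrite extensionE// extension_out// subr0 ger0_norm; last first.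
    by apply: dirichlet_ge0; exact: subset_closure.
  have nO : ~ Om (a + (1 : R) *: (b - a)) by rewrite scale1r addrC subrK.
  have [t /andP[t0 t1] ht] := segment_boundary oO Oa ler01 nO.
  apply: (le_trans (dirichlet_cone_bdry ht Oa)); rewrite ler_pM2l//.
  rewrite opprD addrA subrr add0r enormN enormZ gtr0_norm// enormB.
  by rewrite ler_piMl// enorm_ge0.
have [Ox|nOx] := pselect (Om x); have [Oy|nOy] := pselect (Om y).
- rewrite !extensionE// ler_norml.
  have := dirichlet_lip Ox Oy; have := dirichlet_lip Oy Ox.
  by rewrite (enormB y); lra.
- exact: out.
- by rewrite distrC enormB; exact: out.
- by rewrite !extension_out// subrr normr0 mulr_ge0 ?enorm_ge0// ltW.
Qed.

Lemma extension_bound x : 0 <= extension x <= 1.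
Proof.
have [Ox|nOx] := pselect (Om x).
  by rewrite extensionE// dirichlet_ge0 ?dirichlet_le1//; exact: subset_closure.
by rewrite extension_out// lexx ler01.
Qed.

Lemma extension_x0 : extension x0 = 1.
Proof. by rewrite extensionE// dirichlet_x0. Qed.

End dirichlet.

(** * Lebesgue measure *)

Section lebesgue_rV_facts.
Context {R : realType}.
Local Open Scope ereal_scope.

Definition box n (A : 'I_n -> set (measurableTypeR R)) : set 'rV[R]_n :=
  [set x | forall i, A i (x ord0 i)].

Lemma measurable_box n (A : 'I_n -> set (measurableTypeR R)) :
  (forall i, measurable (A i)) -> measurable (box A).
Proof.
move=> mA; rewrite (_ : box A = \bigcap_(i in [set: 'I_n])
    ((fun y : 'rV[R]_n => y ord0 i) @^-1` A i)); last first.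
  by apply/seteqP; split=> y /= h i => [_|]; exact: h.
apply: fin_bigcap_measurable => [|i _]; first exact: finite_finset.
by rewrite -[X in measurable X]setTI; exact: measurable_coord.
Qed.

(** Measurability is generated by coordinates, so an open set is written as the countable union of
    the boxes with rational corners that it contains. *)
Lemma open_measurable_rV n (A : set 'rV[R]_n) : open A -> measurable A.
Proof.
move=> oA.
pose B (p : 'rV[rat]_n * 'rV[rat]_n) : set 'rV[R]_n :=
  box (fun i => `]ratr (p.1 ord0 i), ratr (p.2 ord0 i)[%classic).
pose C p := if pselect (B p `<=` A) then B p else set0.
have -> : A = \bigcup_p C p.
  apply/seteqP; split=> [x Ax|x [p _]]; last first.
    by rewrite /C; case: pselect => // h; exact: h.
  move: oA; rewrite openE => /(_ _ Ax)/nbhs_ballP[e /= e0 eA].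
  have lo i : {q : rat | ratr q \in `](x ord0 i - e)%R, x ord0 i[}.
    by apply: cid; apply: rat_in_itvoo; rewrite ltrBlDr ltrDl.
  have up i : {q : rat | ratr q \in `]x ord0 i, (x ord0 i + e)%R[}.
    by apply: cid; apply: rat_in_itvoo; rewrite ltrDl.
  pose p := (\row_i sval (lo i), \row_i sval (up i)).
  have pA : B p `<=` A.
    move=> y By; apply: eA; split => // i j; rewrite ord1.
    have := By j; rewrite /= !mxE in_itv/= => /andP[yl yu].
    have := svalP (lo j); have := svalP (up j); rewrite !in_itv/=.
    move=> /andP[_ u1] /andP[l1 _]; rewrite /ball/= ltr_distlC.
    by rewrite (lt_trans l1 yl) (lt_trans yu u1).
  exists p => //; rewrite /C; case: pselect => // _ i /=.
  rewrite !mxE in_itv/=.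
  have := svalP (lo i); have := svalP (up i); rewrite !in_itv/=.
  by move=> /andP[-> _] /andP[_ ->].
apply: countable_bigcupT_measurable => // p.
have mB : measurable (B p) by apply: measurable_box => i; exact: measurable_itv.
by rewrite /C; case: pselect => ? /=; [exact: mB|exact: measurable0].
Qed.

Lemma closed_measurable_rV n (A : set 'rV[R]_n) : closed A -> measurable A.
Proof.
by move=> cA; rewrite -(setCK A); apply: measurableC; apply: open_measurable_rV; exact: closed_openC.
Qed.

Lemma continuous_measurable_rV n (f : 'rV[R]_n -> R) : continuous f ->
  measurable_fun [set: 'rV[R]_n] (f : 'rV[R]_n -> measurableTypeR R).
Proof.
move=> /continuousP cf; apply: (measurability _ (RGenOpens.measurableE R)).
move=> _ [_ [a [b ->] <-]]; rewrite setTI; apply: open_measurable_rV.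
by apply: cf; exact: interval_open.
Qed.

Lemma measurable_add_cst (c : R) : measurable_fun [set: measurableTypeR R]
  (fun t : measurableTypeR R => (t + c)%R : measurableTypeR R).
Proof. exact: measurable_funD. Qed.

Lemma lebesgue_measure_shift (c : R) (A : set (measurableTypeR R)) :
  measurable A -> lebesgue_measure [set t : R | A (t + c)%R] = lebesgue_measure A.
Proof.
move=> mA.
pose phi : {mfun measurableTypeR R >-> measurableTypeR R} :=
  mfun_Sub (mem_set (measurable_add_cst c)).
apply/esym; apply: (@lebesgue_measure_unique R (pushforward lebesgue_measure phi)) => // _ [[a b] _ <-].
rewrite /= /pushforward.
rewrite (_ : _ @^-1` _ = `](a - c)%R, (b - c)%R]%classic); last first.
  by apply/seteqP; split=> t /=; rewrite !in_itv/= ltrBlDr lerBrDr.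
rewrite !lebesgue_measure_itv/= !lte_fin ltrD2r -!EFinD.
by rewrite opprB addrA addrNK.
Qed.

Definition shift_rV n (h x : 'rV[R]_n) : 'rV[R]_n := (x + h)%R.

Lemma measurable_shift_rV n (h : 'rV[R]_n) : measurable_fun setT (shift_rV h).
Proof.
apply: measurable_fun_rVP => i.
rewrite (_ : (fun x => _) = (fun x : 'rV[R]_n => (x ord0 i + h ord0 i)%R)); last first.
  by apply/funext => x; rewrite mxE.
exact: (measurableT_comp (measurable_add_cst _) (measurable_coord i)).
Qed.

Lemma measurable_rV_boxes n : @measurable _ 'rV[R]_n =
  <<s [set box A | A in [set A : 'I_n -> set (measurableTypeR R) |
         forall i, measurable (A i)]] >>.
Proof.
apply/seteqP; split.
  apply: smallest_sub; first exact: smallest_sigma_algebra.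
  rewrite -bigcup_seq/=; apply: bigcup_sub => i _ _ [A mA <-].
  apply: sub_sigma_algebra.
  exists (fun j => if j == i then A else setT).
    by move=> j /=; case: ifP.
  apply/seteqP; split=> x /=.
    by move=> /(_ i); rewrite eqxx.
  by move=> [_ Ax] j; case: ifP => // /eqP ->.
apply: smallest_sub; first exact: sigma_algebra_measurable.
by move=> _ [A mA <-]; exact: measurable_box.
Qed.

Lemma lebesgue_rV_box_lty n (a b : 'I_n -> R) :
  lebesgue_rV n (box (fun i => `[a i, b i]%classic)) < +oo.
Proof.
rewrite lebesgue_rV_box; last by move=> i; exact: measurable_itv.
rewrite ltey_eq; apply/orP; left.
elim/big_ind : _ => [//|x y|i _]; first exact: fin_numM.
by rewrite /= lebesgue_measure_itv/=; case: ifP.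
Qed.

(** The measure and its image under the shift agree on boxes, a generating family stable under
    intersection, and cubes of finite measure exhaust the space. *)
Lemma lebesgue_rV_shift n (h : 'rV[R]_n) (A : set 'rV[R]_n) : measurable A ->
  lebesgue_rV n [set x | A (x + h)%R] = lebesgue_rV n A.
Proof.
move=> mA.
pose phi : {mfun 'rV[R]_n >-> 'rV[R]_n} :=
  mfun_Sub (mem_set (measurable_shift_rV h)).
apply/esym; apply: (@measure_unique _ R 'rV[R]_n _
  (fun k => box (fun=> `[(- k%:R)%R, k%:R]%classic)) (measurable_rV_boxes n)
  _ _ _ (lebesgue_rV n) (pushforward (lebesgue_rV n) phi)) => //.
- move=> _ _ [B mB <-] [C mC <-].
  exists (fun i => B i `&` C i); first by move=> i; exact: measurableI.
  apply/seteqP; split=> [x BC|x [Bx Cx] i]; last by split.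
  by split=> i; have [] := BC i.
- by move=> k; exists (fun=> `[(- k%:R)%R, k%:R]%classic) => // i; exact: measurable_itv.
- apply/seteqP; split=> // x _; exists (Num.bound `|x|%R) => // i /=.
  rewrite in_itv/= -ler_norml (le_trans (coord_le_norm _ _))//.
  by apply/ltW/archi_boundP.
- move=> _ [B mB <-]; rewrite /= /pushforward.
  rewrite (_ : _ @^-1` _ = box (fun i => [set t | B i (t + h ord0 i)%R])); last first.
    by apply/seteqP; split=> x /= Bx i; have := Bx i; rewrite mxE.
  rewrite !lebesgue_rV_box//; last first.
    move=> i; rewrite -[X in measurable X]setTI.
    exact: (measurable_add_cst (h ord0 i)).
  by apply: eq_bigr => i _; rewrite lebesgue_measure_shift.
- by move=> k; exact: lebesgue_rV_box_lty.
Qed.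

Lemma lebesgue_rV_bounded n (A : set 'rV[R]_n) : measurable A -> bounded_set A ->
  lebesgue_rV n A < +oo.
Proof.
move=> mA /bounded_enormP[M M0 hM].
apply: le_lt_trans (lebesgue_rV_box_lty (fun=> (- M)%R) (fun=> M)).
apply: le_measure; rewrite ?inE//; first by apply: measurable_box => i; exact: measurable_itv.
move=> x /hM xM i /=; rewrite in_itv/= -ler_norml.
exact: le_trans (enorm_coord _ _) xM.
Qed.

Lemma lebesgue_rV_open_gt0 n (A : set 'rV[R]_n) : open A -> A !=set0 ->
  0 < lebesgue_rV n A.
Proof.
move=> oA [x Ax].
have /nbhs_ballP[e /= e0 eA] : nbhs x A by move: oA; rewrite openE; exact.
pose B := box (fun i : 'I_n => `](x ord0 i - e)%R, (x ord0 i + e)%R[%classic).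
have mB : measurable B by apply: measurable_box => i; exact: measurable_itv.
apply: (@lt_le_trans _ _ (lebesgue_rV n B)).
  rewrite lebesgue_rV_box; last by move=> i; exact: measurable_itv.
  elim/big_ind : _ => [//|a b a0 b0|i _]; first exact: mule_gt0.
  rewrite /= lebesgue_measure_itv/= lte_fin ltrD2l gtrN// -EFinD lte_fin.
  by rewrite opprB addrC addrA subrK addr_gt0.
apply: le_measure; rewrite ?inE//; first exact: open_measurable_rV.
move=> y By; apply: eA; split => // i j; rewrite ord1.
by have := By j; rewrite /= in_itv/= /ball/= ltr_distlC.
Qed.

End lebesgue_rV_facts.

(** * Generalized limits and densities of dominated charges *)

Definition bounded_seq {R : realType} (a : nat -> R) : Prop :=
  exists M : R, forall n, `|a n| <= M.

(* Realized by the limit along a free ultrafilter; it replaces the extraction of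
   weakly convergent subsequences. *)
Definition is_generalized_limit {R : realType} (Lm : (nat -> R) -> R) : Prop :=
  [/\ forall a b, bounded_seq a -> bounded_seq b ->
        Lm (fun n => a n + b n) = Lm a + Lm b,
      forall c a, bounded_seq a -> Lm (fun n => c * a n) = c * Lm a,
      forall a M, bounded_seq a -> (\forall n \near \oo, a n <= M) -> Lm a <= M &
      forall a l, a @ \oo --> l -> Lm a = l].

(** A bounded sequence maps the ultrafilter to an ultrafilter on a compact interval, which
    converges. The ultrafilter refines the filter at infinity, so eventual bounds and ordinary
    limits are respected. *)
Lemma generalized_limit_exists (R : realType) :
  exists Lm : (nat -> R) -> R, is_generalized_limit Lm.
Proof.
have [F [FU sF]] := @ultraFilterLemma nat \oo _.
have FP : ProperFilter F by apply: ultra_proper.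
have cvgF (a : nat -> R) : bounded_seq a -> cvg (a @ F).
  move=> [M hM].
  have := @segment_compact R (- M) M; rewrite compact_ultra => /(_ (a @ F)).
  have FA : (a @ F) `[- M, M]%classic.
    suff : F (a @^-1` `[- M, M]%classic) by [].
    by apply: filterE => n /=; rewrite in_itv/= -ler_norml; exact: hM.
  have UA : UltraFilter (a @ F).
    split=> [|G GP aG]; first exact: fmap_proper_filter.
    rewrite predeqE => A; split=> [GA|/aG//].
    have [//|nA] := in_ultra_setVsetC (a @^-1` A) FU.
    have GnA : G (~` A) by exact: aG.
    by have /filter_ex[? []] : G (A `&` ~` A) by exact: filterI.
  by move=> /(_ UA FA)[l [_ hl]]; apply/cvg_ex; exists l.
exists (fun a => lim (a @ F)); split.
- by move=> a b /cvgF ca /cvgF cb; apply: limD.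
- move=> c a /cvgF ca; apply: cvg_lim => //.
  by apply: cvgMl_tmp.
- move=> a M /cvgF ca aM; apply: limr_le => //; exact: sF.
- move=> a l al; apply: cvg_lim => //; apply: cvg_trans al.
  by move=> A /sF.
Qed.

Section bounded_integrals.
Context d (T : measurableType d) (R : realType).
Variable mu : {measure set T -> \bar R}.
Implicit Types (A B : set T) (f g : T -> R).

Lemma bounded_integrable B f (C : R) : measurable B -> (mu B < +oo)%E ->
  measurable_fun B f -> (forall x, B x -> `|f x| <= C) ->
  mu.-integrable B (EFin \o f).
Proof.
move=> mB Boo mf fC; apply: measurable_bounded_integrable => //.
exists C; split; first exact: num_real.
by move=> y Cy x Bx; exact: le_trans (fC _ Bx) (ltW Cy).
Qed.

Lemma Rintegral_bound B f (C : R) : measurable B -> (mu B < +oo)%E ->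
  measurable_fun B f -> (forall x, B x -> `|f x| <= C) ->
  `|\int[mu]_(x in B) f x| <= C * fine (mu B).
Proof.
move=> mB Boo mf fC; have intf := bounded_integrable mB Boo mf fC.
apply: (le_trans (le_normr_Rintegral mB intf)).
rewrite -Rintegral_cst//; apply: le_Rintegral => //.
- have mnf : measurable_fun B (fun x => `|f x|) by exact: measurableT_comp.
  by apply: (@bounded_integrable _ _ C) => // x Bx; rewrite normr_id fC.
- by apply: (@bounded_integrable _ _ `|C|) => //.
Qed.

End bounded_integrals.

(** Finite additivity is enough: domination makes [nu] of the tails of a disjoint union tend to 0,
    whence countable additivity, and it also gives absolute continuity for Radon-Nikodym. *)
Lemma dominated_density d (T : measurableType d) (R : realType)
    (mu : {sigma_finite_measure set T -> \bar R}) (D : set T) (C : R)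
    (nu : set T -> R) :
  measurable D -> (mu D < +oo)%E ->
  (forall A B, measurable A -> measurable B -> A `&` B = set0 ->
     nu (A `|` B) = nu A + nu B) ->
  (forall A, measurable A -> `|nu A| <= C * fine (mu (A `&` D))) ->
  exists g : T -> R, mu.-integrable setT (EFin \o g) /\
    forall A, measurable A -> nu A = \int[mu]_(x in A) g x.
Proof.
move=> mD Doo nuD nuC.
have C0 A : measurable A -> 0 <= C * fine (mu (A `&` D)).
  by move=> mA; exact: le_trans (nuC _ mA).
have fm A : measurable A -> mu (A `&` D) \is a fin_num.
  move=> mA; rewrite ge0_fin_numE//; apply: le_lt_trans Doo.
  by apply: le_measure; rewrite ?inE//; exact: measurableI.
have nu0 : nu set0 = 0.
  apply/eqP; rewrite -normr_le0; apply: le_trans (nuC _ measurable0) _.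
  by rewrite set0I measure0 mulr0.
pose nuE A := (nu A)%:E.
have nuE0 : nuE set0 = 0%E by rewrite /nuE nu0.
have nufin A : measurable A -> nuE A \is a fin_num by [].
have nuS : semi_sigma_additive nuE.
  move=> F mF tF mUF.
  pose P n := \big[setU/set0]_(i < n) F i.
  have mP n : measurable (P n) by exact: bigsetU_measurable.
  have PS n : P n.+1 = P n `|` F n by rewrite /P big_ord_recr.
  have PF n : P n `&` F n = set0.
    rewrite /P; apply/seteqP; split=> // x [+ Fx].
    rewrite -bigcup_mkord => -[i /= ni Fi].
    have /trivIsetP/(_ i n I I) := tF; rewrite (ltn_eqF ni) => /(_ isT).
    by move=> /seteqP[+ _]; apply; split; [exact: Fi|exact: Fx].
  have nuP n : nu (P n) = \sum_(0 <= i < n) nu (F i).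
    elim: n => [|n IH]; first by rewrite /P big_ord0 big_nil.
    by rewrite PS nuD// big_nat_recr//= IH.
  have PU n : P n `<=` \bigcup_i F i.
    by rewrite /P -bigcup_mkord => x [i _ Fi]; exists i.
  rewrite (_ : (fun n => _) = EFin \o (fun n => nu (P n))); last first.
    by apply/funext => n /=; rewrite nuP sumEFin.
  have mcvg : fine (mu (P n `&` D)) @[n --> \oo] -->
      fine (mu (\bigcup_i F i `&` D)).
    apply: fine_cvg; rewrite fineK; last exact: fm.
    have -> : \bigcup_i F i `&` D = \bigcup_n (P n `&` D).
      rewrite -setI_bigcupl; congr (_ `&` _); apply/seteqP; split=> x.
        by move=> [i _ Fi]; exists i.+1 => //; rewrite PS; right.
      by move=> [n _ /PU].
    apply: nondecreasing_cvg_mu.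
    - by move=> n; exact: measurableI.
    - by apply: bigcupT_measurable => n; exact: measurableI.
    - move=> n m nm; apply/subsetPset; apply: setSI.
      by rewrite /P -!bigcup_mkord; apply: bigcup_sub => i /= ni x Fi; exists i => //=; exact: leq_trans nm.
  apply: cvg_EFin; first exact: nearW.
  apply/cvgrPdist_le => e e0.
  have C1 : 0 < `|C| + 1 by rewrite ltr_wpDl.
  have /cvgrPdist_le/(_ (e / (`|C| + 1))) := mcvg.
  rewrite divr_gt0// => /(_ isT); apply: filterS => n hn /=.
  set UF := \bigcup_i F i in hn *.
  have UE : UF = P n `|` (UF `\` P n) by rewrite setDUK.
  rewrite {1}UE nuD//; last 2 first.
    exact: measurableD.
    by rewrite setIDA setIC -setIDA setDv setI0.
  rewrite addrAC subrr add0r.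
  apply: le_trans (nuC _ _) _; first exact: measurableD.
  have DE : fine (mu (UF `&` D)) - fine (mu (P n `&` D)) =
      fine (mu ((UF `\` P n) `&` D)).
    rewrite {1}UE setIUl measureU; last 3 first.
    - exact: measurableI.
    - by apply: measurableI => //; exact: measurableD.
    - by rewrite setIACA [X in X `&` _](_ : _ = set0) ?set0I// setIDA setIC -setIDA setDv setI0.
    have f1 := fm _ (mP n).
    have f2 := fm _ (measurableD mUF (mP n)).
    by rewrite (fineD f1 f2) addrAC subrr add0r.
  rewrite DE ger0_norm ?fine_ge0// in hn.
  apply: (@le_trans _ _ ((`|C| + 1) * fine (mu ((UF `\` P n) `&` D)))).
    by apply: ler_wpM2r; rewrite ?fine_ge0// (le_trans (ler_norm _))// lerDl.
  by rewrite mulrC -ler_pdivlMr.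
pose nuc : {charge set T -> \bar R} :=
  HB.pack nuE (isCharge.Build d T R nuE nuE0 nufin nuS).
have dom : nuc `<< mu.
  move=> A hA B mB BA; have muB : mu B = 0%E by exact: hA.
  rewrite /= /nuE; congr EFin; apply/eqP; rewrite -normr_le0.
  apply: le_trans (nuC _ mB) _.
  rewrite (_ : mu (B `&` D) = 0%E) ?mulr0//.
  by apply: hA; [exact: measurableI|move=> x [/BA]].
exists (fine \o Radon_Nikodym nuc mu).
have E : EFin \o (fine \o Radon_Nikodym nuc mu) = Radon_Nikodym nuc mu.
  by apply/funext => x /=; rewrite fineK// Radon_Nikodym_fin_num.
split; first by rewrite E; exact: Radon_Nikodym_integrable.
move=> A mA; rewrite /Rintegral.
have := Radon_Nikodym_integral dom mA.
by rewrite -E /= /nuE => <-.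
Qed.

(** * Translations, and tests on open sets *)

Section translation.
Context {R : realType} {N : nat}.
Let mu := @lebesgue_rV R N.
Implicit Types (A B O : set 'rV[R]_N) (f : 'rV[R]_N -> R) (h x : 'rV[R]_N).

Definition translate h A : set 'rV[R]_N := [set x | A (x - h)].

Lemma measurable_translate h A : measurable A -> measurable (translate h A).
Proof.
move=> mA; have := measurable_shift_rV (- h) measurableT mA.
by rewrite setTI.
Qed.

Lemma lebesgue_translate h A : measurable A -> mu (translate h A) = mu A.
Proof. by move=> mA; rewrite -(lebesgue_rV_shift (- h) mA). Qed.

Lemma Rintegral_shift B h f : measurable B -> measurable_fun setT f ->
  mu.-integrable B (EFin \o (fun x => f (x + h))) ->
  \int[mu]_(x in B) f (x + h) = \int[mu]_(x in translate h B) f x.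
Proof.
move=> mB mf intf.
pose phi : {mfun 'rV[R]_N >-> 'rV[R]_N} :=
  mfun_Sub (mem_set (measurable_shift_rV h)).
have mT := measurable_translate h mB.
have E : forall A, measurable A -> mu A = pushforward mu phi A.
  by move=> A mA; rewrite /= /pushforward -(lebesgue_rV_shift h mA).
have BE : phi @^-1` (translate h B) = B.
  by apply/seteqP; split=> x /=; rewrite /translate/= /shift_rV addrK.
have P := @integral_pushforward _ _ _ _ R phi (measurable_shift_rV h) mu
  (translate h B) (EFin \o f).
rewrite BE in P.
rewrite /Rintegral; congr fine.
transitivity (\int[pushforward mu phi]_(y in translate h B) (f y)%:E)%E; last first.
  by apply: eq_measure_integral => A mA _; rewrite /= -E.
rewrite P//; exact/measurable_EFinP.
Qed.

(** The points at distance at least 1/(k+1) from the complement. They lie in O and in its translate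
    by h once |h| < 1/(k+1), and they exhaust O when O is open. *)
Definition inner_set O (k : nat) : set 'rV[R]_N :=
  [set x | forall y, enorm (y - x) < k.+1%:R^-1 -> O y].

Lemma measurable_inner_set O k : measurable (inner_set O k).
Proof.
apply: closed_measurable_rV; rewrite -openC; apply/openP => x /existsNP[y].
move=> /not_implyP[yx nOy]; exists (k.+1%:R^-1 - enorm (y - x)).
  by rewrite subr_gt0.
move=> w wx hw; apply: nOy; apply: hw.
rewrite ltrBrDr in wx; apply: le_lt_trans wx.
by rewrite [leRHS]addrC (enormB w x); exact: ler_enorm_dist.
Qed.

Lemma inner_set_cvg O : open O -> mu (inner_set O k) @[k --> \oo] --> mu O.
Proof.
move=> oO; have E : O = \bigcup_k inner_set O k.
  apply/seteqP; split=> [x Ox|x [k _]]; last first.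
    by apply; rewrite subrr enorm0 invr_gt0.
  have [r r0 hr] := (openP O).1 oO x Ox.
  exists (Num.bound r^-1) => // y yx; apply: hr; apply: (lt_le_trans yx).
  rewrite -[leRHS]invrK lef_pV2 ?posrE ?invr_gt0//.
  apply: (le_trans (ltW (archi_boundP _))); first by rewrite invr_ge0 ltW.
  by rewrite ler_nat.
rewrite [X in _ --> mu X]E.
apply: nondecreasing_cvg_mu.
- by move=> k; exact: measurable_inner_set.
- by rewrite -E; exact: open_measurable_rV.
- move=> i j ij; apply/subsetPset => x h y yx; apply: h.
  by apply: (lt_le_trans yx); rewrite lef_pV2 ?posrE// ler_nat.
Qed.

Lemma overlap_cvg O (h : nat -> 'rV[R]_N) : open O -> (mu O < +oo)%E ->
  (forall r : R, 0 < r -> \forall n \near \oo, enorm (h n) < r) ->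
  fine (mu (O `&` translate (h n) O)) @[n --> \oo] --> fine (mu O).
Proof.
move=> oO Ooo h0; have mO := open_measurable_rV oO.
have fO A : measurable A -> A `<=` O -> mu A \is a fin_num.
  move=> mA AO; rewrite ge0_fin_numE//; apply: le_lt_trans Ooo.
  by apply: le_measure; rewrite ?inE.
have iO k : inner_set O k `<=` O.
  by move=> x; apply; rewrite subrr enorm0 invr_gt0.
have := inner_set_cvg oO.
rewrite -(fineK (fO _ mO (@subset_refl _ _))) => /fine_cvg /cvgrPdist_le hc.
apply/cvgrPdist_le => e /hc[k _ /(_ k (leqnn k))] /=.
have le1 : fine (mu (inner_set O k)) <= fine (mu O).
  apply: fine_le; [exact: fO (measurable_inner_set O k) (iO k)|exact: fO|].
  by apply: le_measure; rewrite ?inE//; exact: measurable_inner_set.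
rewrite ger0_norm ?subr_ge0// => hk.
have := h0 k.+1%:R^-1; rewrite invr_gt0 ltr0n => /(_ isT); apply: filterS => n hn.
have mI : measurable (O `&` translate (h n) O).
  by apply: measurableI => //; exact: measurable_translate.
have sub : inner_set O k `<=` O `&` translate (h n) O.
  move=> x hx; split; first exact: iO hx.
  by apply: hx; rewrite addrAC subrr add0r enormN.
have fI : mu (O `&` translate (h n) O) \is a fin_num by apply: fO => // x [].
have le2 : fine (mu (O `&` translate (h n) O)) <= fine (mu O).
  by apply: fine_le => //; [exact: fO|apply: le_measure; rewrite ?inE// => x []].
have le3 : fine (mu (inner_set O k)) <= fine (mu (O `&` translate (h n) O)).
  apply: fine_le => //; first exact: fO (measurable_inner_set O k) (iO k).
  by apply: le_measure; rewrite ?inE//; exact: measurable_inner_set.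
by rewrite ger0_norm ?subr_ge0//; apply: le_trans hk; rewrite lerD2l lerN2.
Qed.

(** After a change of variables the two integrals differ only over the symmetric difference of O and
    its translate, whose two halves have equal measure. *)
Lemma translate_integral_bound O h f (C : R) : measurable O -> (mu O < +oo)%E ->
  measurable_fun setT f -> (forall x, `|f x| <= C) ->
  `|\int[mu]_(x in O) f (x + h) - \int[mu]_(x in O) f x| <=
    2 * C * (fine (mu O) - fine (mu (O `&` translate h O))).
Proof.
move=> mO Ooo mf fC; set T := translate h O.
have mT : measurable T by exact: measurable_translate.
have Too : (mu T < +oo)%E by rewrite lebesgue_translate.
have intf A : measurable A -> (mu A < +oo)%E -> mu.-integrable A (EFin \o f).
  by move=> mA Aoo; apply: (@bounded_integrable _ _ _ _ _ _ C) => //; exact: measurable_funTS.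
have sub A B : measurable A -> measurable B -> A `<=` B -> (mu B < +oo)%E -> (mu A < +oo)%E.
  by move=> mA mB AB; apply: le_lt_trans; apply: le_measure; rewrite ?inE.
have split A B : measurable A -> measurable B -> (mu A < +oo)%E ->
   \int[mu]_(x in A) f x = \int[mu]_(x in A `&` B) f x + \int[mu]_(x in A `\` B) f x /\
   fine (mu A) = fine (mu (A `&` B)) + fine (mu (A `\` B)).
  move=> mA mB Aoo.
  have AE : A = (A `&` B) `|` (A `\` B) by rewrite setUIDK.
  have m1 : measurable (A `&` B) by exact: measurableI.
  have m2 : measurable (A `\` B) by exact: measurableD.
  have d12 : (A `&` B) `&` (A `\` B) = set0.
    by apply/seteqP; split=> // x [[_ +] [_]].
  split.
    rewrite {1}AE Rintegral_setU//; first by rewrite -AE; exact: intf.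
    exact/disj_set2P.
  rewrite {1}AE measureU// fineD// ge0_fin_numE//.
    by apply: sub Aoo => // x [].
  by apply: sub Aoo => // x [].
rewrite Rintegral_shift//; last first.
  apply: (@bounded_integrable _ _ _ _ _ _ C) => //.
  apply: measurable_funTS.
  by apply: (measurableT_comp mf); exact: measurable_shift_rV.
have [-> E1] := split T O mT mO Too; have [-> E2] := split O T mO mT Ooo.
rewrite (setIC T O) in E1 *.
rewrite opprD addrACA subrr add0r.
have mOT : measurable (O `\` T) by exact: measurableD.
have mTO : measurable (T `\` O) by exact: measurableD.
have b1 : `|\int[mu]_(x in T `\` O) f x| <= C * fine (mu (T `\` O)).
  apply: Rintegral_bound => //; last exact: measurable_funTS.
  by apply: sub Too => // x [].
have b2 : `|\int[mu]_(x in O `\` T) f x| <= C * fine (mu (O `\` T)).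
  apply: Rintegral_bound => //; last exact: measurable_funTS.
  by apply: sub Ooo => // x [].
rewrite lebesgue_translate// in E1.
apply: (le_trans (ler_normB _ _)); apply: (le_trans (lerD b1 b2)).
have -> : fine (mu (T `\` O)) = fine (mu O) - fine (mu (O `&` T)) by rewrite {1}E1 addrAC subrr add0r.
have -> : fine (mu (O `\` T)) = fine (mu O) - fine (mu (O `&` T)) by rewrite {1}E2 addrAC subrr add0r.
by rewrite -mulrA mulr_natl mulr2n.
Qed.

End translation.

Lemma measurable_rV_open {R : realType} n :
  @measurable _ 'rV[R]_n = <<s [set A : set 'rV[R]_n | open A] >>.
Proof.
apply/seteqP; split; last first.
  by apply: smallest_sub; [exact: sigma_algebra_measurable|exact: open_measurable_rV].
apply: smallest_sub; first exact: smallest_sigma_algebra.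
rewrite -bigcup_seq/=; apply: bigcup_sub => i _ _ [A mA <-].
pose T := g_sigma_algebraType [set A : set 'rV[R]_n | open A].
have : measurable_fun [set: T] (fun x : T => (x : 'rV[R]_n) ord0 i : measurableTypeR R).
  apply: (measurability _ (RGenOpens.measurableE R)).
  move=> _ [_ [a [b ->] <-]]; rewrite setTI; apply: sub_sigma_algebra => /=.
  have /continuousP := @coord_continuous R 1 n ord0 i.
  by apply; exact: interval_open.
by move=> /(_ measurableT A mA).
Qed.

(** Open sets are stable under intersection and generate the measurable sets, while the sets over
    which f integrates to 0 form a Dynkin system. *)
Lemma integral0_open {R : realType} n (f : 'rV[R]_n -> R) :
  (lebesgue_rV n).-integrable setT (EFin \o f) ->
  (forall A, open A -> \int[lebesgue_rV n]_(x in A) f x = 0) ->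
  forall A, measurable A -> \int[lebesgue_rV n]_(x in A) f x = 0.
Proof.
move=> intf h0 A mA.
have intA B : measurable B -> (lebesgue_rV n).-integrable B (EFin \o f).
  by move=> mB; exact: integrableS intf.
suff : (\int[lebesgue_rV n]_(x in A) (f x)%:E = 0)%E by rewrite /Rintegral => ->.
have h0E B : open B -> (\int[lebesgue_rV n]_(x in B) (f x)%:E = 0)%E.
  move=> oB; have mB := open_measurable_rV oB.
  rewrite -[LHS]fineK; last by apply: integrable_fin_num => //; exact: intA.
  by congr EFin; exact: h0.
move: (mA); rewrite measurable_rV_open; move: {mA} A; apply: (@dynkin_induction _ _ [set A : set 'rV[R]_n | open A]
  (fun A => \int[lebesgue_rV n]_(x in A) (f x)%:E = 0)%E).
- exact: measurable_rV_open.
- by move=> A B /= oA oB; exact: openI.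
- by apply: h0E; exact: openT.
- by move=> A /= oA; exact: h0E.
- move=> S mS S0; have := h0E setT openT.
  rewrite -(setUv S) integral_setU//= ?S0 ?add0e//.
  + exact: measurableC.
  + by rewrite setUv; exact: measurable_int intf.
  + by apply/disj_set2P; rewrite setICr.
- move=> F mF tF F0; rewrite integral_bigcup//; last first.
    by apply: intA; exact: bigcupT_measurable.
  by rewrite eseries0.
Qed.

(** Cauchy's functional equation: removing the integer part bounds d a - a d 1 by 2K for every a >=
    0. Applied to all multiples n a, this bound forces the difference to be 0. *)
Lemma additive_bounded_linear {R : realType} (d : R -> R) (K : R) :
  (forall a b, d (a + b) = d a + d b) -> (forall a, `|d a| <= K * `|a|) ->
  forall c, d c = c * d 1.
Proof.
move=> dD dK c.
have d0 : d 0 = 0 by have := dD 0 0; rewrite addr0; lra.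
have dN a : d (- a) = - d a by have := dD a (- a); rewrite subrr d0; lra.
have dM (n : nat) a : d (n%:R * a) = n%:R * d a.
  elim: n => [|n IH]; first by rewrite !mul0r.
  by rewrite -addn1 natrD !mulrDl !mul1r dD IH.
have K0 : 0 <= K by have := dK 1; rewrite normr1 mulr1; apply: le_trans.
have bd a : 0 <= a -> `|d a - a * d 1| <= 2 * K.
  move=> a0; have /andP[na an] := truncn_itv a0.
  set n := Num.truncn a in na an.
  have -> : d a = n%:R * d 1 + d (a - n%:R).
    by rewrite -dM mulr1 -dD addrC subrK.
  have -> : n%:R * d 1 + d (a - n%:R) - a * d 1 = d (a - n%:R) - (a - n%:R) * d 1.
    by ring.
  have r1 : `|a - n%:R| <= 1.
    by rewrite ger0_norm ?subr_ge0// lerBlDl natr1 ltW.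
  apply: (le_trans (ler_normB _ _)); rewrite normrM (_ : 2 * K = K + K); last by ring.
  apply: lerD.
    by apply: (le_trans (dK _)); rewrite ler_piMr.
  have := dK 1; rewrite normr1 mulr1 => d1.
  by apply: le_trans d1; rewrite ler_piMl.
have pos a : 0 <= a -> d a = a * d 1.
  move=> a0; apply/eqP; rewrite -subr_eq0 -normr_le0 leNgt; apply/negP => h.
  pose n := (Num.bound (2 * K / `|d a - a * d 1|)).
  have hn : 2 * K / `|d a - a * d 1| < n%:R.
    by apply: archi_boundP; rewrite divr_ge0 ?mulr_ge0.
  have := bd (n%:R * a); rewrite mulr_ge0// => /(_ isT).
  rewrite dM -mulrA -mulrBr normrM normr_nat leNgt => /negP; apply.
  by rewrite -ltr_pdivrMr.
have [c0|c0] := leP 0 c; first exact: pos.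
by rewrite -[in LHS](opprK c) dN pos ?oppr_ge0 ?(ltW c0)// mulNr opprK.
Qed.

Lemma ae_le_of_integral {R : realType} d (T : measurableType d)
    (mu : {measure set T -> \bar R}) (Om : set T) (f : T -> R) (C : R) :
  measurable Om -> (mu Om < +oo)%E -> mu.-integrable Om (EFin \o f) ->
  (forall A, measurable A -> A `<=` Om ->
     \int[mu]_(x in A) f x <= C * fine (mu A)) ->
  {ae mu, forall x, Om x -> f x <= C}.
Proof.
move=> mOm Ooo intf hA.
have mf : measurable_fun Om f by apply/measurable_EFinP; exact: measurable_int intf.
pose A k : set T := Om `&` f @^-1` `[C + k.+1%:R^-1, +oo[%classic.
have mA k : measurable (A k) by exact: mf.
have AO k : A k `<=` Om by move=> x [].
have Aoo k : (mu (A k) < +oo)%E.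
  by apply: le_lt_trans Ooo; apply: le_measure; rewrite ?inE.
have A0 k : mu (A k) = 0%E.
  have h := hA _ (mA k) (AO k).
  have : (C + k.+1%:R^-1) * fine (mu (A k)) <= C * fine (mu (A k)).
    apply: le_trans h; rewrite -Rintegral_cst//; apply: le_Rintegral => //.
    - by apply: (@bounded_integrable _ _ _ _ _ _ `|C + k.+1%:R^-1|).
    - exact: integrableS intf.
    - by move=> x [_] /=; rewrite in_itv/= andbT.
  rewrite mulrDl gerDl pmulr_rle0 ?invr_gt0// => h0.
  rewrite -(@fineK _ (mu (A k))); last by rewrite ge0_fin_numE.
  by congr EFin; apply/eqP; rewrite eq_le h0 fine_ge0.
have : mu.-negligible (\bigcup_k A k).
  by apply: negligible_bigcup => k; exists (A k); split.
apply: negligibleS => x /not_implyP[Ox /negP]; rewrite -ltNge => Cf.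
exists (Num.bound (f x - C)^-1) => //; split=> //=; rewrite in_itv/= andbT.
rewrite -lerBrDl -[leRHS]invrK lef_pV2 ?posrE ?invr_gt0 ?subr_gt0//.
apply: (le_trans (ltW (archi_boundP _))); last by rewrite ler_nat.
by rewrite invr_ge0 subr_ge0 ltW.
Qed.

(** * The weak gradient of a Lipschitz function *)

Section test_functions.
Context {R : realType} {N : nat}.
Implicit Types (phi f : 'rV[R]_N -> R) (x : 'rV[R]_N) (Om K : set 'rV[R]_N).

Lemma compact_support_bounded f K : continuous f -> compact K ->
  (forall x, ~ K x -> f x = 0) -> exists M : R, forall x, `|f x| <= M.
Proof.
move=> cf cK f0.
have /compact_bounded[M [_ hM]] : compact (f @` K).
  by apply: continuous_compact => //; exact: continuous_subspaceT.
exists (`|M| + 1) => x; have [Kx|nKx] := pselect (K x); last first.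
  by rewrite f0// normr0 addr_ge0.
by apply: hM; [rewrite (le_lt_trans (ler_norm _))// ltrDl|exists x].
Qed.

Lemma test_function_out Om phi x : test_function Om phi -> ~ Om x -> phi x = 0.
Proof.
move=> [_ _ sub] nO; apply: contrapT => /eqP phi0.
by apply: nO; apply: sub; exact: subset_closure.
Qed.

Lemma test_function_derive Om phi i x : test_function Om phi ->
  is_derive x (Defs.basis i) phi (partial i phi x).
Proof.
by move=> [/(_ 1)[_ /(_ i)[+ _]] _ _] => /(_ x I) h; exact: derivableP.
Qed.

Lemma test_function_continuous Om phi : test_function Om phi -> continuous phi.
Proof. by move=> [/(_ 0)[h _] _ _] x; exact: h. Qed.

Lemma test_function_partial_continuous Om phi i : test_function Om phi ->
  continuous (partial i phi).
Proof. by move=> [/(_ 1)[_ /(_ i)[_ [h _]]] _ _] x; exact: h. Qed.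

Lemma test_function_bounded Om phi : test_function Om phi ->
  exists M : R, forall x, `|phi x| <= M.
Proof.
move=> tphi; have cphi := test_function_continuous tphi.
case: tphi => _ cK _; apply: (compact_support_bounded cphi cK) => x nK.
by apply: contrapT => /eqP phi0; apply: nK; exact: subset_closure.
Qed.

Lemma test_function_partial_bounded Om phi i : test_function Om phi ->
  exists M : R, forall x, `|partial i phi x| <= M.
Proof.
move=> tphi; have cp := @test_function_partial_continuous _ _ i tphi.
case: tphi => _ cK _; apply: (compact_support_bounded cp cK) => x nK.
have : open (~` closure [set y | phi y != 0]) by rewrite openC; exact: closed_closure.
move=> /openP/(_ _ nK)[r r0 hr].
have h : is_derive x (Defs.basis i) phi 0.
  have c0 : is_derive x (Defs.basis i) (cst 0 : 'rV[R]_N -> R) 0 by exact: is_derive_cst.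
  apply: near_eq_is_derive c0.
  apply/nbhs_enormP; exists r => // y /hr ny.
  by apply: esym; apply: contrapT => /eqP phi0; apply: ny; exact: subset_closure.
by case: h.
Qed.

Lemma is_derive_line phi x v (s d : R) : is_derive (x + s *: v) v phi d ->
  is_derive s 1 (fun t : R => phi (x + t *: v)) d.
Proof.
move=> /is_derive_lineP h.
have -> : (fun t : R => phi (x + t *: v)) =
    (fun k : R => phi (k *: v + (x + s *: v))) \o (fun t => t - s).
  by apply/funext => t /=; rewrite addrCA -scalerDl subrK.
rewrite -[d]mulr1; apply: is_derive1_comp; first by rewrite subrr.
exact: is_derive_shift.
Qed.

Lemma test_function_lip Om phi i : test_function Om phi -> exists2 C : R, 0 <= C &
  forall x (h : R), 0 <= h -> `|phi x - phi (x - h *: Defs.basis i)| <= C * h.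
Proof.
move=> tphi; have [C hC] := test_function_partial_bounded i tphi.
exists C => [|x h h0]; first exact: le_trans (hC 0).
pose F (t : R) : R := phi (x + t *: Defs.basis i).
have dF (t : R) : is_derive t 1 F (partial i phi (x + t *: Defs.basis i)).
  by apply: is_derive_line; exact: test_function_derive tphi.
have cF : {within `[- h, 0], continuous F}.
  by apply: derivable_within_continuous => t _; case: (dF t).
have [|c _] := @MVT_segment R F (fun t => partial i phi (x + t *: Defs.basis i))
    (- h) 0 _ (fun t _ => dF t) cF.
  by rewrite oppr_le0.
rewrite /F scale0r addr0 scaleNr sub0r opprK => ->.
by rewrite normrM (ger0_norm h0) ler_wpM2r.
Qed.

(** The quotient is backward because a forward difference of U becomes a backward difference of phi
    under the change of variables in [quot_pairing_shift]. *)
Lemma test_function_quot_cvg Om phi i x : test_function Om phi ->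
  n.+1%:R * (phi x - phi (x - n.+1%:R^-1 *: Defs.basis i)) @[n --> \oo] -->
  partial i phi x.
Proof.
move=> tphi; have [dphi <-] := test_function_derive i x tphi.
set e := Defs.basis i in dphi *.
have h0 : (forall n : nat, - (n.+1%:R : R)^-1 != 0) /\
    - (n.+1%:R : R)^-1 @[n --> \oo] --> 0.
  split=> [n|]; first by rewrite oppr_eq0 invr_eq0 pnatr_eq0.
  rewrite -[X in _ --> X]oppr0; apply: cvgN; exact: cvg_harmonic.
have := (cvgr_dnbhsP _ _ _).1 dphi (fun n => - n.+1%:R^-1) h0.
apply: cvg_trans; apply: near_eq_cvg; near=> n => /=.
rewrite invrN invrK scaleNr -scalerN opprB scaleNr.
by rewrite [- _ + x]addrC.
Unshelve. all: by end_near. Qed.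

End test_functions.

(** A bound on a lower Dini derivative, sampled along increments 1/(n+1), bounds the increment. The
    supremum of the t with G t - G 0 <= (M + e) t satisfies this inequality by the Lipschitz
    property, and unless it is 1 a good increment moves past it. *)
Lemma dini_le {R : realType} (G : R -> R) (K M : R) : 0 <= K ->
  (forall s t, `|G s - G t| <= K * `|s - t|) ->
  (forall t e (k : nat), 0 <= t < 1 -> 0 < e -> exists2 n, (k <= n)%N &
     n.+1%:R * (G (t + n.+1%:R^-1) - G t) <= M + e) ->
  G 1 - G 0 <= M.
Proof.
move=> K0 lipG dini; apply/ler_addgt0Pr => e e0.
pose S := [set t : R | 0 <= t <= 1 /\ G t - G 0 <= (M + e) * t].
have S0 : S 0 by split; rewrite ?lexx ?ler01// subrr mulr0.
have hS : has_sup S by split; [exists 0|exists 1 => t [/andP[]]].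
set s := sup S.
have s0 : 0 <= s by exact: (ub_le_sup hS.2).
have s1 : s <= 1 by apply: (ge_sup hS.1) => t [/andP[]].
have Ss : G s - G 0 <= (M + e) * s.
  apply/ler_addgt0Pr => r r0.
  pose C := K + `|M + e| + 1.
  have C0 : 0 < C by rewrite ltr_wpDl// addr_ge0.
  have [t [t01 tG] st] := sup_adherent (divr_gt0 r0 C0) hS.
  have ts : t <= s by apply: (ub_le_sup hS.2); split.
  have h1 : G s - G t <= K * (s - t).
    have := lipG s t; rewrite (@ger0_norm _ (s - t)) ?subr_ge0//.
    exact: le_trans (ler_norm _).
  have h2 : (M + e) * (t - s) <= `|M + e| * (s - t).
    by rewrite -opprB mulrN -mulNr ler_wpM2r ?subr_ge0// -normrN ler_norm.
  have h3 : C * (s - t) < r.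
    by rewrite mulrC -ltr_pdivlMr// ltrBlDr -ltrBlDl.
  have h4 : (K + `|M + e|) * (s - t) <= C * (s - t).
    by rewrite ler_wpM2r ?subr_ge0// lerDl.
  rewrite mulrBr in h2; rewrite mulrDl in h4; lra.
have [s1E|s_neq1] := eqVneq s 1; first by move: Ss; rewrite s1E mulr1.
have {s_neq1} s_lt1 : s < 1 by rewrite lt_neqAle s_neq1.
(* The index is taken large enough for s + 1/(n+1) to stay in [0, 1]. *)
have := dini s e (Num.bound (1 - s)^-1); rewrite s0 s_lt1 => /(_ isT e0)[n hn hG].
have n0 : 0 < n.+1%:R^-1 :> R by rewrite invr_gt0.
have ns : n.+1%:R^-1 <= 1 - s.
  rewrite -[leRHS]invrK lef_pV2 ?posrE ?invr_gt0 ?subr_gt0//.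
  apply: (le_trans (ltW (archi_boundP _))); first by rewrite invr_ge0 subr_ge0.
  by rewrite ler_nat leqW.
have : S (s + n.+1%:R^-1).
  split; first by rewrite addr_ge0 ?(ltW n0)//= addrC -lerBrDr.
  rewrite -[X in X - _](subrK (G s)) -addrA mulrDr [leRHS]addrC; apply: lerD => //.
  by rewrite ler_pdivlMr// mulrC.
by move=> /(ub_le_sup hS.2); rewrite leNgt ltrDl n0.
Qed.

Section lipschitz_gradient.
Context {R : realType} {N : nat}.
Variables (Om : set 'rV[R]_N) (U : 'rV[R]_N -> R) (L : R).
Variable Lm : (nat -> R) -> R.
Hypotheses (oOm : open Om) (bOm : bounded_set Om) (L0 : 0 <= L).
Hypothesis lipU : forall x y, `|U x - U y| <= L * enorm (x - y).
Hypothesis hLm : is_generalized_limit Lm.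
Hypothesis bU : forall x, `|U x| <= 1.
Implicit Types (v w x : 'rV[R]_N) (A B : set 'rV[R]_N).
Let mu := @lebesgue_rV R N.

Let mOm : measurable Om. Proof. exact: open_measurable_rV. Qed.

Let Ooo : (mu Om < +oo)%E. Proof. exact: lebesgue_rV_bounded. Qed.

Let AOoo A : measurable A -> (mu (A `&` Om) < +oo)%E.
Proof.
move=> mA; apply: le_lt_trans Ooo; apply: le_measure; rewrite ?inE//.
by apply: measurableI.
Qed.

Lemma Lm_norm (a : nat -> R) (M : R) : (forall n, `|a n| <= M) -> `|Lm a| <= M.
Proof.
case: hLm => _ hZ hle _ aM; have ba : bounded_seq a by exists M.
rewrite ler_norml; apply/andP; split; last first.
  by apply: hle => //; apply: nearW => n; exact: le_trans (ler_norm _) (aM n).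
rewrite lerNl -[- Lm a]mulN1r -hZ//; apply: hle.
  by exists M => n; rewrite mulN1r normrN.
apply: nearW => n; rewrite mulN1r; apply: le_trans (aM n).
by rewrite -normrN; exact: ler_norm.
Qed.

Definition diff_quot (n : nat) v x : R :=
  n.+1%:R * (U (x + n.+1%:R^-1 *: v) - U x).

Lemma diff_quot_bound n v x : `|diff_quot n v x| <= L * enorm v.
Proof.
rewrite /diff_quot normrM normr_nat.
apply: (@le_trans _ _ (n.+1%:R * (L * (n.+1%:R^-1 * enorm v)))).
  rewrite ler_wpM2l//; apply: (le_trans (lipU _ _)).
  by rewrite addrAC subrr add0r enormZ ger0_norm// invr_ge0.
by rewrite mulrCA mulVKf// pnatr_eq0.
Qed.

Lemma continuous_U : continuous U.
Proof. exact: lipschitz_continuous lipU. Qed.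

Lemma diff_quot_continuous n v : continuous (diff_quot n v).
Proof.
apply: (@lipschitz_continuous _ _ _ (n.+1%:R * (L + L))) => x y.
rewrite /diff_quot -mulrBr normrM normr_nat -mulrA ler_wpM2l//.
rewrite (_ : U (x + _) - U x - _ = (U (x + n.+1%:R^-1 *: v) -
  U (y + n.+1%:R^-1 *: v)) + (U y - U x)); last by ring.
rewrite mulrDl; apply: (le_trans (ler_normD _ _)); apply: lerD; last first.
  by rewrite (enormB x).
apply: (le_trans (lipU _ _)).
by rewrite opprD addrACA subrr addr0.
Qed.

Lemma diff_quot_measurable n v B : measurable_fun B (diff_quot n v).
Proof.
by apply: measurable_funTS; apply: continuous_measurable_rV; exact: diff_quot_continuous.
Qed.

Lemma diff_quot_integrable n v A : measurable A -> (mu A < +oo)%E ->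
  mu.-integrable A (EFin \o diff_quot n v).
Proof.
move=> mA Aoo; apply: (@bounded_integrable _ _ _ _ _ _ (L * enorm v)) => //.
  exact: diff_quot_measurable.
by move=> x _; exact: diff_quot_bound.
Qed.

Definition quot_integral v A (n : nat) : R :=
  \int[mu]_(x in A `&` Om) diff_quot n v x.

Lemma quot_integral_bound v A n : measurable A ->
  `|quot_integral v A n| <= L * enorm v * fine (mu (A `&` Om)).
Proof.
move=> mA; apply: Rintegral_bound => //.
- exact: measurableI.
- exact: AOoo.
- exact: diff_quot_measurable.
- by move=> x _; exact: diff_quot_bound.
Qed.

Lemma bounded_quot_integral v A : measurable A -> bounded_seq (quot_integral v A).
Proof.
by move=> mA; exists (L * enorm v * fine (mu (A `&` Om))) => n; exact: quot_integral_bound.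
Qed.

Definition weak_quot v A : R := Lm (quot_integral v A).

Lemma weak_quot_bound v A : measurable A ->
  `|weak_quot v A| <= L * enorm v * fine (mu (A `&` Om)).
Proof. by move=> mA; apply: Lm_norm => n; exact: quot_integral_bound. Qed.

Lemma weak_quotU v A B : measurable A -> measurable B -> A `&` B = set0 ->
  weak_quot v (A `|` B) = weak_quot v A + weak_quot v B.
Proof.
move=> mA mB AB; rewrite /weak_quot; case: hLm => hD _ _ _.
rewrite -hD; [|exact: bounded_quot_integral|exact: bounded_quot_integral].
congr Lm; apply/funext => n; rewrite /quot_integral setIUl Rintegral_setU//.
- exact: measurableI.
- exact: measurableI.
- rewrite -setIUl; apply: diff_quot_integrable; last by apply: AOoo; exact: measurableU.
  by apply: measurableI => //; exact: measurableU.
- by apply/disj_set2P; rewrite setIACA AB set0I.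
Qed.

Lemma cvg_scaled (w : 'rV[R]_N) (r : R) : 0 < r ->
  \forall n \near \oo, enorm (n.+1%:R^-1 *: w) < r.
Proof.
move=> r0; exists (Num.bound (enorm w / r)) => // n /= hn.
rewrite enormZ ger0_norm ?invr_ge0// mulrC ltr_pdivrMr// mulrC -ltr_pdivrMr//.
apply: (lt_le_trans (archi_boundP _)); first by rewrite divr_ge0 ?enorm_ge0// ltW.
by rewrite ler_nat leqW.
Qed.

(* diff_quot n (v + w) is diff_quot n w plus a translate of diff_quot n v, and
   on an open set the translation error vanishes in the limit. *)
Lemma weak_quotD_open v w A : open A ->
  weak_quot (v + w) A = weak_quot v A + weak_quot w A.
Proof.
move=> oA; have mA := open_measurable_rV oA; case: hLm => hD _ _ hl.
have oO : open (A `&` Om) by exact: openI.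
have mO : measurable (A `&` Om) by exact: open_measurable_rV.
have OO := AOoo mA.
pose h n : 'rV[R]_N := n.+1%:R^-1 *: w.
pose a n := \int[mu]_(x in A `&` Om) diff_quot n v (x + h n) - quot_integral v A n.
have ishift n : mu.-integrable (A `&` Om) (EFin \o (fun x => diff_quot n v (x + h n))).
  apply: (@bounded_integrable _ _ _ _ _ _ (L * enorm v)) => //.
    apply: measurable_funTS.
    apply: (measurableT_comp (@diff_quot_measurable n v setT)).
    exact: measurable_shift_rV.
  by move=> x _; exact: diff_quot_bound.
have E n : quot_integral (v + w) A n = (a n + quot_integral v A n) + quot_integral w A n.
  rewrite subrK /quot_integral -RintegralD//; last exact: diff_quot_integrable.
  apply: eq_Rintegral => x _; rewrite /diff_quot -mulrDr; congr (_ * _).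
  rewrite (_ : x + n.+1%:R^-1 *: (v + w) = x + h n + n.+1%:R^-1 *: v).
    by ring.
  by rewrite scalerDr (addrC (_ *: v)) addrA.
have a0 : a @ \oo --> (0 : R).
  have ov := overlap_cvg oO OO (fun r r0 => @cvg_scaled w r r0).
  apply: (@squeeze_cvgr _ _ _ _
    (fun n => - (2 * (L * enorm v) * (fine (mu (A `&` Om)) - fine (mu (A `&` Om `&` translate (h n) (A `&` Om))))))
    (fun n => 2 * (L * enorm v) * (fine (mu (A `&` Om)) - fine (mu (A `&` Om `&` translate (h n) (A `&` Om)))))).
  - apply: nearW => n; rewrite -ler_norml.
    apply: translate_integral_bound => //; first exact: diff_quot_measurable.
    by move=> x; exact: diff_quot_bound.
  - rewrite -oppr0; apply: cvgN; rewrite -[X in _ --> X](mulr0 (2 * (L * enorm v))).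
    by apply: cvgMl_tmp; rewrite -(subrr (fine (mu (A `&` Om)))); apply: cvgB; [exact: cvg_cst|exact: ov].
  - rewrite -[X in _ --> X](mulr0 (2 * (L * enorm v))).
    by apply: cvgMl_tmp; rewrite -(subrr (fine (mu (A `&` Om)))); apply: cvgB; [exact: cvg_cst|exact: ov].
have ba : bounded_seq a.
  exists (L * enorm v * fine (mu (A `&` Om)) + L * enorm v * fine (mu (A `&` Om))) => n.
  apply: (le_trans (ler_normB _ _)); apply: lerD; last exact: quot_integral_bound.
  apply: Rintegral_bound => //; last by move=> x _; exact: diff_quot_bound.
  by have /measurable_int/measurable_EFinP := ishift n.
have bv := bounded_quot_integral v mA.
have bw := bounded_quot_integral w mA.
rewrite /weak_quot; have -> : quot_integral (v + w) A =
    (fun n => (a n + quot_integral v A n) + quot_integral w A n).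
  by apply/funext => n; exact: E.
have bav : bounded_seq (fun n => a n + quot_integral v A n).
  case: ba => Ma hMa; case: bv => Mv hMv; exists (Ma + Mv) => n.
  by apply: (le_trans (ler_normD _ _)); exact: lerD.
by rewrite (hD _ _ bav bw) (hD _ _ ba bv) (hl _ _ a0) add0r.
Qed.

Lemma weak_density_exists v : exists g : 'rV[R]_N -> R,
  mu.-integrable setT (EFin \o g) /\
  forall A, measurable A -> weak_quot v A = \int[mu]_(x in A) g x.
Proof.
apply: (@dominated_density _ _ R mu Om (L * enorm v)) => //.
  exact: weak_quotU.
exact: weak_quot_bound.
Qed.

Definition weak_density v : 'rV[R]_N -> R := sval (cid (weak_density_exists v)).

Lemma weak_density_integrable v A : measurable A ->
  mu.-integrable A (EFin \o weak_density v).
Proof.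
move=> mA; apply: (integrableS measurableT) => //.
exact: (svalP (cid (weak_density_exists v))).1.
Qed.

Lemma weak_densityE v A : measurable A ->
  weak_quot v A = \int[mu]_(x in A) weak_density v x.
Proof.
by move=> mA; exact: (svalP (cid (weak_density_exists v))).2.
Qed.

(** Additivity is known on open sets, where the translation error vanishes. The defect has an
    integrable density, so [integral0_open] carries it to all measurable sets. *)
Lemma weak_quotD v w A : measurable A ->
  weak_quot (v + w) A = weak_quot v A + weak_quot w A.
Proof.
pose f x := weak_density (v + w) x - (weak_density v x + weak_density w x).
have i2 B : measurable B -> mu.-integrable B (EFin \o (fun x => weak_density v x + weak_density w x)).
  by move=> mB; apply: (@integrableD _ _ _ mu B mB (EFin \o weak_density v) (EFin \o weak_density w)); exact: weak_density_integrable.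
have fE B : measurable B ->
    \int[mu]_(x in B) f x = weak_quot (v + w) B - (weak_quot v B + weak_quot w B).
  move=> mB; rewrite /f RintegralB//; [|exact: weak_density_integrable|exact: i2].
  rewrite RintegralD//; [|exact: weak_density_integrable|exact: weak_density_integrable].
  by rewrite -!weak_densityE.
move=> mA; apply/eqP; rewrite -subr_eq0 -fE//; apply/eqP.
apply: integral0_open mA.
  exact: (@integrableB _ _ _ mu setT measurableT (EFin \o weak_density (v + w))
    (EFin \o (fun x => weak_density v x + weak_density w x))
    (weak_density_integrable _ measurableT) (i2 _ measurableT)).
move=> B oB; rewrite fE; last exact: open_measurable_rV.
by rewrite weak_quotD_open// subrr.
Qed.

(** Rescaling v also changes the step of the quotients, so homogeneity is not immediate; it follows
    from additivity in c and a bound proportional to |c|. *)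
Lemma weak_quotZ c v A : measurable A -> weak_quot (c *: v) A = c * weak_quot v A.
Proof.
move=> mA; rewrite -[in RHS](scale1r v).
apply: (@additive_bounded_linear _ (fun c => weak_quot (c *: v) A)
  (L * enorm v * fine (mu (A `&` Om)))) => [a b|a].
  by rewrite scalerDl weak_quotD.
apply: (le_trans (weak_quot_bound _ mA)); rewrite enormZ.
by rewrite le_eqVlt; apply/orP; left; apply/eqP; ring.
Qed.

Definition weak_grad x : 'rV[R]_N := \row_i weak_density (Defs.basis i) x.

Lemma weak_grad_sum v A (s : seq 'I_N) : measurable A ->
  mu.-integrable A (EFin \o (fun x =>
    \sum_(i <- s) v ord0 i * weak_density (Defs.basis i) x)) /\
  \int[mu]_(x in A) (\sum_(i <- s) v ord0 i * weak_density (Defs.basis i) x) =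
  \sum_(i <- s) v ord0 i * weak_quot (Defs.basis i) A.
Proof.
move=> mA; elim: s => [|i s [IHi IH]].
  have -> : (fun x : 'rV[R]_N => \sum_(i <- [::])
      v ord0 i * weak_density (Defs.basis i) x) = cst 0.
    by apply/funext => x; rewrite big_nil.
  by rewrite big_nil Rintegral_cst// mul0r; split=> //; exact: integrable0.
have -> : (fun x : 'rV[R]_N => \sum_(j <- i :: s)
    v ord0 j * weak_density (Defs.basis j) x) =
    (fun x => v ord0 i * weak_density (Defs.basis i) x +
      \sum_(j <- s) v ord0 j * weak_density (Defs.basis j) x).
  by apply/funext => x; rewrite big_cons.
have ii : mu.-integrable A (EFin \o (fun x => v ord0 i * weak_density (Defs.basis i) x)).
  apply: (@integrableZl _ _ _ mu A mA (v ord0 i) (EFin \o weak_density (Defs.basis i))).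
  exact: weak_density_integrable.
split; first exact: (@integrableD _ _ _ mu A mA _ _ ii IHi).
rewrite RintegralD// big_cons IH RintegralZl//; last exact: weak_density_integrable.
by rewrite -weak_densityE.
Qed.

Lemma dot_weak_grad v x : dot v (weak_grad x) =
  \sum_i v ord0 i * weak_density (Defs.basis i) x.
Proof. by apply: eq_bigr => i _; rewrite mxE. Qed.

Lemma weak_grad_integrable v A : measurable A ->
  mu.-integrable A (EFin \o (fun x => dot v (weak_grad x))).
Proof.
move=> mA; rewrite (_ : (fun x => dot v (weak_grad x)) = (fun x =>
    \sum_i v ord0 i * weak_density (Defs.basis i) x)).
  by case: (weak_grad_sum v (index_enum _) mA).
by apply/funext => x; exact: dot_weak_grad.
Qed.

Lemma weak_gradE v A : measurable A ->
  weak_quot v A = \int[mu]_(x in A) dot v (weak_grad x).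
Proof.
move=> mA; under eq_Rintegral do rewrite dot_weak_grad.
have [_ ->] := weak_grad_sum v (index_enum _) mA.
rewrite [in LHS](row_sum_delta v).
rewrite (@big_morph _ _ (fun w => weak_quot w A) 0 +%R).
- by apply: eq_bigr => i _; exact: weak_quotZ.
- by move=> w z; exact: weak_quotD.
- by rewrite -(scale0r 0) weak_quotZ// mul0r.
Qed.

Lemma weak_grad_bound (L' : R) (v : 'rV[R]_N) A : 0 <= L' -> measurable A -> A `<=` Om ->
  {ae mu, forall x, Om x -> enorm (weak_grad x) <= L'} ->
  `|weak_quot v A| <= L' * enorm v * fine (mu A).
Proof.
move=> L'0 mA AO hae; rewrite weak_gradE//.
have Aoo : (mu A < +oo)%E by rewrite -(setIidl AO); exact: AOoo.
have ig := weak_grad_integrable v mA.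
apply: (le_trans (le_normr_Rintegral mA ig)).
rewrite -Rintegral_cst//.
have inorm : mu.-integrable A (EFin \o (fun x => `|dot v (weak_grad x)|)).
  exact: (integrable_norm ig).
have icst : mu.-integrable A (EFin \o cst (L' * enorm v)).
  by apply: (@bounded_integrable _ _ _ _ _ _ `|L' * enorm v|) => //.
rewrite /Rintegral; apply: fine_le.
- exact: integrable_fin_num.
- exact: integrable_fin_num.
apply: ae_ge0_le_integral => //.
- exact: measurable_int inorm.
- by move=> x _; rewrite lee_fin mulr_ge0// enorm_ge0.
- apply: filterS hae => x hx Ax; rewrite lee_fin mulrC.
  by apply: (le_trans (cauchy_schwarz _ _)); rewrite ler_wpM2l ?enorm_ge0// hx//; exact: AO.
Qed.

(* Rational directions suffice, so that there is only one null set. *)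
Lemma weak_grad_le : {ae mu, forall x, Om x -> enorm (weak_grad x) <= L}.
Proof.
have H (q : 'rV[rat]_N) : {ae mu, forall x, Om x ->
    dot (map_mx ratr q) (weak_grad x) <= L * enorm (map_mx ratr q : 'rV[R]_N)}.
  apply: ae_le_of_integral => //; first exact: weak_grad_integrable.
  move=> A mA AO; rewrite -weak_gradE//; apply: (le_trans (ler_norm _)).
  by apply: (le_trans (weak_quot_bound _ mA)); rewrite (setIidl AO).
have : \forall x \ae mu, forall n, Om x -> match (unpickle n : option 'rV[rat]_N) with
    | Some q => dot (map_mx ratr q) (weak_grad x) <=
                L * enorm (map_mx ratr q : 'rV[R]_N)
    | None => true end.
  apply/ae_foralln => n; case: unpickle => [q|]; first exact: H.
  exact: aeW.
apply: filterS => x hx Ox; set g := weak_grad x.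
have {}hx (q : 'rV[rat]_N) : dot (map_mx ratr q) g <= L * enorm (map_mx ratr q : 'rV[R]_N).
  by have := hx (pickle q) Ox; rewrite pickleK.
have [->|g0] := eqVneq g 0; first by rewrite enorm0.
have eg : 0 < enorm g by rewrite enorm_gt0.
rewrite leNgt; apply/negP => Lg.
(* The direction g itself would give |g|^2 <= L|g|, short by 2 e|g|. A rational p costs at most |p -
   g| (L + |g|), hence the tolerance below. *)
pose e := (enorm g - L) / 2.
have e0 : 0 < e by rewrite divr_gt0// subr_gt0.
have Lg0 : 0 < L + enorm g by exact: ltr_wpDl.
have [q hq] : exists q : 'rV[rat]_N,
    enorm (map_mx ratr q - g) < e * enorm g / (L + enorm g).
  have r0 : 0 < e * enorm g / (L + enorm g) by exact: divr_gt0 (mulr_gt0 e0 eg) Lg0.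
  set r := _ / _ in r0 *.
  have r1 : 0 < r / (N%:R + 1) by rewrite divr_gt0// ltr_wpDl.
  have hi i : {s : rat | ratr s \in `]g ord0 i, (g ord0 i + r / (N%:R + 1))[}.
    by apply: cid; apply: rat_in_itvoo; rewrite ltrDl.
  have [q hq] : exists q : 'I_N -> rat, forall i,
      g ord0 i < ratr (q i) < g ord0 i + r / (N%:R + 1).
    by exists (fun i => sval (hi i)) => i; have := svalP (hi i); rewrite in_itv.
  exists (\row_i q i).
  apply: (le_lt_trans (enorm_le_norm _)).
  apply: (@le_lt_trans _ _ (N%:R * (r / (N%:R + 1)))).
    apply: ler_wpM2l => //; rewrite [leLHS]/Num.Def.normr/= mx_normrE.
    apply/bigmax_leP; split=> [|[i j] _ /=]; first exact: ltW.
    rewrite (ord1 i) !mxE; have /andP[h1 h2] := hq j; rewrite !mxE in h1 h2 *.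
    by rewrite gtr0_norm ?subr_gt0// lerBlDl ltW.
  have N1 : 0 < N%:R + 1 :> R by rewrite ltr_wpDl.
  by rewrite mulrCA gtr_pMr// ltr_pdivrMr// mul1r ltrDl.
have h1 := hx q.
set p : 'rV[R]_N := map_mx ratr q in hq h1.
have h2 : enorm p <= enorm g + enorm (p - g).
  by rewrite addrC; have := ler_enormD (p - g) g; rewrite subrK.
have h3 : dot p g = dot g g + dot (p - g) g by rewrite -dotDl addrC subrK.
have h4 : - (enorm (p - g) * enorm g) <= dot (p - g) g.
  by have := cauchy_schwarz (p - g) g; rewrite ler_norml => /andP[].
rewrite -sqr_enorm in h3.
have h5 : enorm (p - g) * (L + enorm g) < e * enorm g.
  by rewrite -ltr_pdivlMr.
have h6 : L * enorm p <= L * (enorm g + enorm (p - g)) by rewrite ler_wpM2l.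
have h7 : e * enorm g = (enorm g ^+ 2 - L * enorm g) / 2 by rewrite /e; ring.
have h8 : 0 < e * enorm g by rewrite mulr_gt0.
lra.
Qed.


(** Integrating over the moving set turns the spatial quotient into the forward quotient of the
    one-variable function t |-> integral of U(x + t w) over A, the form that [dini_le] accepts. *)
Lemma quot_integral_line w A (t : R) (n : nat) : measurable A ->
  translate (t *: w) A `<=` Om ->
  quot_integral w (translate (t *: w) A) n =
  n.+1%:R * (\int[mu]_(x in A) U (x + (t + n.+1%:R^-1) *: w) -
             \int[mu]_(x in A) U (x + t *: w)).
Proof.
move=> mA AO.
have mT : measurable (translate (t *: w) A) by exact: measurable_translate.
have Aoo : (mu A < +oo)%E.
  rewrite -(lebesgue_translate (t *: w) mA); apply: le_lt_trans Ooo.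
  by apply: le_measure; rewrite ?inE.
have iU (s : R) : mu.-integrable A (EFin \o (fun x => U (x + s *: w))).
  apply: (@bounded_integrable _ _ _ _ _ _ 1) => //.
  apply: measurable_funTS.
  apply: (measurableT_comp (continuous_measurable_rV continuous_U)).
  exact: measurable_shift_rV.
rewrite /quot_integral setIidl// -Rintegral_shift//; last 2 first.
  exact: diff_quot_measurable.
  apply: (@bounded_integrable _ _ _ _ _ _ (L * enorm w)) => //.
    apply: measurable_funTS.
    apply: (measurableT_comp (@diff_quot_measurable n w setT)).
    exact: measurable_shift_rV.
  by move=> x _; exact: diff_quot_bound.
rewrite -RintegralB// -RintegralZl//; last first.
  exact: (@integrableB _ _ _ mu A mA _ _ (iU (t + n.+1%:R^-1)) (iU t)).
apply: eq_Rintegral => x _; rewrite /diff_quot.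
by rewrite scalerDl addrA.
Qed.

(* The increment along w is read off averages over a ball of radius r at x0, which
   replaces a pointwise bound by the almost everywhere one. *)
Lemma weak_grad_lower (L' r : R) x0 w : 0 <= L' -> 0 < r ->
  {ae mu, forall x, Om x -> enorm (weak_grad x) <= L'} ->
  (forall t x, 0 <= t <= 1 -> enorm (x - x0) < r -> Om (x + t *: w)) ->
  U x0 - U (x0 + w) <= L' * enorm w + 2 * L * r.
Proof.
move=> L'0 r0 hae hO.
pose A := [set x | enorm (x - x0) < r].
have oA : open A.
  apply/openP => y /= yr; exists (r - enorm (y - x0)) => [|v]; first by rewrite subr_gt0.
  by rewrite ltrBrDr; apply: le_lt_trans; exact: ler_enorm_dist.
have mA : measurable A by exact: open_measurable_rV.
have AO (t : R) : 0 <= t <= 1 -> translate (t *: w) A `<=` Om.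
  by move=> t01 x Ax; rewrite -(subrK (t *: w) x); exact: hO.
have Aoo : (mu A < +oo)%E.
  have := AO 0; rewrite lexx ler01 => /(_ isT) A0.
  have mT := measurable_translate (0 *: w) mA.
  rewrite -(lebesgue_translate (0 *: w) mA); apply: le_lt_trans Ooo.
  by apply: le_measure; rewrite ?inE.
have iU (s : R) : mu.-integrable A (EFin \o (fun x => U (x + s *: w))).
  apply: (@bounded_integrable _ _ _ _ _ _ 1) => //.
  apply: measurable_funTS.
  apply: (measurableT_comp (continuous_measurable_rV continuous_U)).
  exact: measurable_shift_rV.
have icst (c : R) : mu.-integrable A (EFin \o cst c).
  by apply: (@bounded_integrable _ _ _ _ _ _ `|c|).
set m := fine (mu A).
have m0 : 0 < m.
  apply: fine_gt0; rewrite Aoo andbT; apply: lebesgue_rV_open_gt0 => //.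
  by exists x0; rewrite /A /= subrr enorm0.
pose G t := - \int[mu]_(x in A) U (x + t *: w).
have G01 : G 1 - G 0 <= L' * enorm w * m.
  apply: (@dini_le _ _ (L * enorm w * m)).
  - by rewrite !mulr_ge0 ?enorm_ge0// ltW.
  - move=> s t; rewrite /G opprK addrC -RintegralB//.
    rewrite mulrAC; apply: Rintegral_bound => //.
      by apply/measurable_EFinP; apply: measurable_int; exact: (@integrableB _ _ _ mu A mA _ _ (iU t) (iU s)).
    move=> x _; apply: (le_trans (lipU _ _)).
    by rewrite enorm_line -mulrA [_ * `|s - t|]mulrC distrC.
  (* Otherwise the quotients of [G] exceed the bound by more than e for all n >= k, so the
     generalized limit exceeds it by at least e in absolute value, contrary to [weak_grad_bound]. *)
  - move=> t e k /andP[t0 t1] e0; apply: contrapT => hn.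
    have t01 : 0 <= t <= 1 by rewrite t0 ltW.
    have mT := measurable_translate (t *: w) mA.
    have := weak_grad_bound w L'0 mT (AO _ t01) hae.
    rewrite lebesgue_translate// -/m; apply/negP; rewrite -ltNge.
    apply: (@lt_le_trans _ _ (L' * enorm w * m + e)); first by rewrite ltrDl.
    rewrite -normrN; apply: le_trans (ler_norm _); rewrite lerNr.
    case: hLm => _ _ hle _; apply: hle; first exact: bounded_quot_integral.
    exists k => // n /= kn; rewrite quot_integral_line//; last exact: AO.
    rewrite leNgt; apply/negP => h; apply: hn; exists n => //.
    rewrite ltrNl in h; apply: ltW; apply: le_lt_trans h; rewrite /G opprK.
    by rewrite le_eqVlt; apply/orP; left; apply/eqP; ring.
(* Replacing the average at either end by the value at the centre costs L r, which accounts for the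
   term 2 L r. *)
have lo : (U x0 - L * r) * m <= - G 0.
  rewrite /G opprK -Rintegral_cst//.
  apply: (@le_Rintegral _ _ _ mu A (fun=> U x0 - L * r) _ mA (icst _) (iU 0)).
  move=> x Ax; rewrite scale0r addr0.
  have := lipU x0 x; rewrite enormB ler_norml => /andP[_ h].
  have : L * enorm (x - x0) <= L * r by rewrite ler_wpM2l// ltW.
  lra.
have hi : - G 1 <= (U (x0 + w) + L * r) * m.
  rewrite /G opprK -Rintegral_cst//.
  apply: (@le_Rintegral _ _ _ mu A _ (fun=> U (x0 + w) + L * r) mA (iU 1) (icst _)).
  move=> x Ax; rewrite scale1r.
  have := lipU (x + w) (x0 + w); rewrite opprD addrACA subrr addr0 ler_norml => /andP[_ h].
  have : L * enorm (x - x0) <= L * r by rewrite ler_wpM2l// ltW.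
  lra.
rewrite -(ler_pM2r m0); lra.
Qed.

Definition bounded_measurable (f : 'rV[R]_N -> R) : Prop :=
  measurable_fun setT f /\ exists M : R, forall x, `|f x| <= M.

Lemma integrable_mul_bounded (h f : 'rV[R]_N -> R) : bounded_measurable f ->
  mu.-integrable Om (EFin \o h) -> mu.-integrable Om (EFin \o (fun x => h x * f x)).
Proof.
move=> [mf [M fM]] ih; have mh : measurable_fun Om h by apply/measurable_EFinP; exact: measurable_int ih.
have iM : mu.-integrable Om (EFin \o (fun x => M * `|h x|)).
  apply: (@integrableZl _ _ _ mu Om mOm M (EFin \o (fun x => `|h x|))).
  exact: integrable_norm ih.
apply: (le_integrable mOm _ _ iM).
  apply/measurable_EFinP; apply: measurable_funM => //; exact: measurable_funTS.
move=> x _ /=; rewrite lee_fin !normrM normr_id mulrC ler_wpM2r//.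
exact: le_trans (fM x) (ler_norm _).
Qed.

Definition quot_pairing v f (n : nat) : R :=
  \int[mu]_(x in Om) (diff_quot n v x * f x).

Lemma quot_pairing_bound v (f : 'rV[R]_N -> R) (M : R) n : measurable_fun setT f ->
  (forall x, `|f x| <= M) ->
  `|quot_pairing v f n| <= L * enorm v * M * fine (mu Om).
Proof.
move=> mf fM; apply: Rintegral_bound => //.
  by apply: measurable_funM; [exact: diff_quot_measurable|exact: measurable_funTS].
by move=> x _; rewrite normrM ler_pM// diff_quot_bound.
Qed.

Lemma bounded_quot_pairing v f : bounded_measurable f ->
  bounded_seq (quot_pairing v f).
Proof.
move=> [mf [M fM]]; exists (L * enorm v * M * fine (mu Om)) => n.
exact: quot_pairing_bound.
Qed.

(** The defect, tested against f, in the weak convergence of the quotients to the component of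
    [weak_grad] along v. [weak_gradE] says that it vanishes on indicators. *)
Definition pairing_gap v f : R :=
  Lm (quot_pairing v f) - \int[mu]_(x in Om) (dot v (weak_grad x) * f x).

Lemma pairing_gap_lin v f1 f2 (a b : R) : bounded_measurable f1 ->
  bounded_measurable f2 -> pairing_gap v (fun x => a * f1 x + b * f2 x) =
  a * pairing_gap v f1 + b * pairing_gap v f2.
Proof.
move=> b1 b2; have ig := weak_grad_integrable v mOm.
have lin (h : 'rV[R]_N -> R) : mu.-integrable Om (EFin \o h) ->
    \int[mu]_(x in Om) (h x * (a * f1 x + b * f2 x)) =
    a * \int[mu]_(x in Om) (h x * f1 x) + b * \int[mu]_(x in Om) (h x * f2 x).
  move=> ih; have i1 := integrable_mul_bounded b1 ih.
  have i2 := integrable_mul_bounded b2 ih.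
  have iZ (c : R) (k : 'rV[R]_N -> R) : mu.-integrable Om (EFin \o k) ->
      mu.-integrable Om (EFin \o (fun x => c * k x)).
    by move=> ik; exact: (@integrableZl _ _ _ mu Om mOm c (EFin \o k)).
  rewrite -!RintegralZl// -RintegralD//; [|exact: iZ|exact: iZ].
  by apply: eq_Rintegral => x _; ring.
rewrite /pairing_gap lin//.
have -> : quot_pairing v (fun x => a * f1 x + b * f2 x) =
    (fun n => a * quot_pairing v f1 n + b * quot_pairing v f2 n).
  by apply/funext => n; rewrite /quot_pairing lin//; exact: diff_quot_integrable.
case: hLm => hD hZ _ _.
have bs1 := bounded_quot_pairing v b1; have bs2 := bounded_quot_pairing v b2.
have bZ (c : R) (s : nat -> R) : bounded_seq s -> bounded_seq (fun n => c * s n).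
  by move=> [M hM]; exists (`|c| * M) => n; rewrite normrM ler_wpM2l.
rewrite hD ?hZ//; [|exact: bZ|exact: bZ].
ring.
Qed.

Lemma bounded_measurable_indic A : measurable A -> bounded_measurable (\1_A : _ -> R).
Proof.
move=> mA; split; first exact: measurable_indic.
by exists 1 => x; rewrite indicE normr_nat lern1 leq_b1.
Qed.

Lemma pairing_gap_indic v A : measurable A -> pairing_gap v \1_A = 0.
Proof.
move=> mA.
have E (h : 'rV[R]_N -> R) : \int[mu]_(x in Om) (h x * \1_A x) =
    \int[mu]_(x in A `&` Om) h x.
  rewrite setIC Rintegral_mkcondr; apply: eq_Rintegral => x _.
  by rewrite patchE indicE; case: ifP; rewrite ?mulr1 ?mulr0.
rewrite /pairing_gap E.
have -> : quot_pairing v \1_A = quot_integral v A.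
  by apply/funext => n; rewrite /quot_pairing E.
rewrite -weak_gradE; last exact: measurableI.
rewrite /weak_quot (_ : quot_integral v (A `&` Om) = quot_integral v A) ?subrr//.
by apply/funext => n; rewrite /quot_integral -setIA setIid.
Qed.

(* Binary expansion: h = (1_A + h') / 2 with A = {h >= 1/2} and 0 <= h' <= 1, and
   indicators have no gap, so each step halves the bound. *)
Lemma pairing_gap_unit v (f : 'rV[R]_N -> R) : measurable_fun setT f -> (forall x, 0 <= f x <= 1) ->
  pairing_gap v f = 0.
Proof.
have ig := weak_grad_integrable v mOm.
pose C := L * enorm v * fine (mu Om) +
  \int[mu]_(x in Om) `|dot v (weak_grad x)|.
have f1 (k : 'rV[R]_N -> R) : (forall x, 0 <= k x <= 1) -> forall x, `|k x| <= 1.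
  by move=> h x; have /andP[h0 h1] := h x; rewrite ger0_norm.
have gapC (h : 'rV[R]_N -> R) : measurable_fun setT h -> (forall x, 0 <= h x <= 1) -> `|pairing_gap v h| <= C.
  move=> mh h01; have h1 := f1 _ h01.
  have bh : bounded_measurable h by split=> //; exists 1.
  apply: (le_trans (ler_normB _ _)); apply: lerD.
    by apply: Lm_norm => n; have := quot_pairing_bound v n mh h1; rewrite mulr1.
  have ih := integrable_mul_bounded bh ig.
  apply: (le_trans (le_normr_Rintegral mOm ih)).
  apply: le_Rintegral => //; first exact: (integrable_norm ih).
    exact: (integrable_norm ig).
  by move=> x _; rewrite normrM ler_piMr.
have main (k : nat) : forall h : 'rV[R]_N -> R, measurable_fun setT h -> (forall x, 0 <= h x <= 1) ->
    `|pairing_gap v h| <= C / 2 ^+ k.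
  elim: k => [|k IH] h mh h01; first by rewrite expr0 divr1; exact: gapC.
  pose A := h @^-1` `[2^-1, +oo[%classic.
  have mA : measurable A by rewrite -[A]setTI; exact: mh.
  pose h' x := 2 * h x - \1_A x.
  have mh' : measurable_fun setT h'.
    apply: measurable_funB; last exact: measurable_indic.
    exact: measurable_funM.
  have h'01 x : 0 <= h' x <= 1.
    have /andP[h0 h1] := h01 x; rewrite /h' indicE.
    have -> : (x \in A) = (2^-1 <= h x).
      by apply/idP/idP; rewrite inE /A /= in_itv/= andbT.
    have [hx|hx] := leP 2^-1 (h x); apply/andP; rewrite ?mulr1n ?mulr0n; split; lra.
  have bh' : bounded_measurable h' by split=> //; exists 1; exact: f1.
  have -> : h = (fun x => 2^-1 * \1_A x + 2^-1 * h' x).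
    by apply/funext => x; rewrite /h'; field.
  rewrite (pairing_gap_lin _ _ _ (bounded_measurable_indic mA) bh').
  rewrite pairing_gap_indic// mulr0 add0r normrM ger0_norm ?invr_ge0//.
  by rewrite exprS invfM mulrCA ler_pM2l ?invr_gt0//; exact: IH.
move=> mf f01; apply/eqP; rewrite -normr_le0 leNgt; apply/negP => gap0.
set e := `|_| in gap0.
have C0 : 0 <= C by exact: le_trans (gapC f mf f01).
pose k := Num.bound (C / e).
have := main k f mf f01; rewrite -/e leNgt => /negP; apply.
rewrite ltr_pdivrMr ?exprn_gt0// -ltr_pdivrMl// mulrC.
apply: (lt_trans (archi_boundP _)); first by rewrite divr_ge0// ltW.
by rewrite -natrX ltr_nat ltn_expl.
Qed.

Lemma pairing_gap0 v f : bounded_measurable f -> pairing_gap v f = 0.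
Proof.
move=> [mf [M fM]].
have M0 : 0 <= M by exact: le_trans (fM 0).
(* An affine change brings f into [0, 1]; M + 1 instead of M keeps the divisor positive when M =
   0. *)
have M1 : 0 < 2 * (M + 1) by rewrite mulr_gt0// ltr_wpDl.
pose h x := (f x + (M + 1)) / (2 * (M + 1)).
have mh : measurable_fun setT h.
  by apply: measurable_funM => //; exact: measurable_funD.
have h01 x : 0 <= h x <= 1.
  have := fM x; rewrite ler_norml => /andP[lo hi].
  rewrite /h divr_ge0 ?(ltW M1)//=; last by lra.
  by rewrite ler_pdivrMr// mul1r; lra.
have bh : bounded_measurable h.
  by split=> //; exists 1 => x; have /andP[h0 h1] := h01 x; rewrite ger0_norm.
have -> : f = (fun x => 2 * (M + 1) * h x + (- (M + 1)) * \1_[set: 'rV[R]_N] x).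
  apply/funext => x; rewrite indicT/= /h mulrCA mulfV ?gt_eqF// mulr1.
  by rewrite mulr1 addrK.
rewrite (pairing_gap_lin _ _ _ bh (bounded_measurable_indic measurableT)).
by rewrite pairing_gap_unit// pairing_gap_indic// !mulr0 addr0.
Qed.

Lemma bounded_continuous (f : 'rV[R]_N -> R) (M : R) : continuous f ->
  (forall x, `|f x| <= M) -> bounded_measurable f.
Proof. by move=> cf fM; split; [exact: continuous_measurable_rV|exists M]. Qed.

(** Discrete integration by parts. There is no boundary term: U(x) phi(x - h) vanishes off [Om]
    because of U, and its translate U(x + h) phi(x) because of phi, so both integrals are over the
    whole space. *)
Lemma quot_pairing_shift phi i n : (forall x, ~ Om x -> U x = 0) ->
  test_function Om phi ->
  quot_pairing (Defs.basis i) phi n = - \int[mu]_(x in Om)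
    (U x * (n.+1%:R * (phi x - phi (x - n.+1%:R^-1 *: Defs.basis i)))).
Proof.
move=> U0 tphi; have cphi := test_function_continuous tphi.
have [M phiM] := test_function_bounded tphi.
set h := n.+1%:R^-1 *: Defs.basis i.
have int (f : 'rV[R]_N -> R) (C : R) : measurable_fun setT f ->
    (forall x, `|f x| <= C) -> mu.-integrable Om (EFin \o f).
  move=> mf fC; apply: (@bounded_integrable _ _ _ _ _ _ C) => //.
  exact: measurable_funTS.
have mU : measurable_fun setT U by apply: continuous_measurable_rV; exact: continuous_U.
have mphi : measurable_fun setT phi by exact: continuous_measurable_rV.
have sh (f : 'rV[R]_N -> R) k : measurable_fun setT f -> measurable_fun setT (fun x => f (x + k)).
  by move=> mf; exact: (measurableT_comp mf (measurable_shift_rV k)).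
have M0 : 0 <= M by exact: le_trans (phiM 0).
have bUphi (x y : 'rV[R]_N) : `|U x * phi y| <= M.
  by rewrite normrM -[M]mul1r ler_pM.
pose k x := U x * phi (x - h).
have mk : measurable_fun setT k by apply: measurable_funM => //; exact: sh.
have kE : \int[mu]_(x in Om) (U (x + h) * phi x) = \int[mu]_(x in Om) k x.
  have kh x : U (x + h) * phi x = k (x + h) by rewrite /k addrK.
  have koff x : ~ Om x -> k x = 0 by move=> /U0; rewrite /k => ->; rewrite mul0r.
  have khoff x : ~ Om x -> k (x + h) = 0.
    by move=> /(test_function_out tphi); rewrite -kh => ->; rewrite mulr0.
  have res (f : 'rV[R]_N -> R) : (forall x, ~ Om x -> f x = 0) -> f \_ Om = f.
    move=> f0; apply/funext => x; rewrite patchE; case: ifPn => //.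
    by rewrite notin_setE => /f0.
  under eq_Rintegral do rewrite kh.
  rewrite Rintegral_mkcond res// [RHS]Rintegral_mkcond (res k)//.
  rewrite Rintegral_shift//.
  rewrite (_ : EFin \o _ = (EFin \o (fun x => k (x + h))) \_ Om).
    apply: (integrable_mkcond (EFin \o (fun x => k (x + h))) mOm).1.
    apply: (int _ M); first exact: sh.
    by move=> x; rewrite -kh.
  apply/funext => x; rewrite patchE; case: ifPn => //.
  by rewrite notin_setE => /khoff /= ->.
have iUp (y : 'rV[R]_N -> 'rV[R]_N) : measurable_fun setT (fun x => phi (y x)) ->
    mu.-integrable Om (EFin \o (fun x => U x * phi (y x))).
  by move=> my; apply: (int _ M) => [|x]; [exact: measurable_funM|exact: bUphi].
have iUh : mu.-integrable Om (EFin \o (fun x => U (x + h) * phi x)).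
  by apply: (int _ M) => [|x]; [apply: measurable_funM => //; exact: sh|exact: bUphi].
have iU0 : mu.-integrable Om (EFin \o (fun x => U x * phi x)) by exact: iUp.
have ik : mu.-integrable Om (EFin \o k) by apply: iUp; exact: sh.
transitivity (n.+1%:R * (\int[mu]_(x in Om) (U (x + h) * phi x) -
    \int[mu]_(x in Om) (U x * phi x))).
  rewrite -RintegralB// -RintegralZl//; last exact: (@integrableB _ _ _ mu Om mOm _ _ iUh iU0).
  by apply: eq_Rintegral => x _; rewrite /diff_quot -mulrBl mulrA.
rewrite kE -opprB mulrN; congr (- _).
rewrite -RintegralB// -RintegralZl//; last exact: (@integrableB _ _ _ mu Om mOm _ _ iU0 ik).
by apply: eq_Rintegral => x _; rewrite /k -mulrBr mulrCA.
Qed.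

(** With no gap, the gradient side is a generalized limit of pairings. With the difference moved
    onto phi, these converge in the ordinary sense by dominated convergence, and the two limits
    agree. *)
Lemma weak_grad_parts phi i : (forall x, ~ Om x -> U x = 0) ->
  test_function Om phi ->
  \int[mu]_(x in Om) (U x * partial i phi x) =
  - \int[mu]_(x in Om) (weak_grad x ord0 i * phi x).
Proof.
move=> U0 tphi; have cphi := test_function_continuous tphi.
have [M phiM] := test_function_bounded tphi.
have /eqP := pairing_gap0 (Defs.basis i) (bounded_continuous cphi phiM).
rewrite /pairing_gap subr_eq0 => /eqP.
under eq_Rintegral do rewrite dotC dot_basisr.
move=> <-; apply/eqP; rewrite -eqr_oppLR; apply/eqP.
have [C C0 phiC] := test_function_lip i tphi.
case: hLm => _ _ _ hl; apply: esym; apply: hl.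
rewrite (_ : quot_pairing _ _ = fun n => - \int[mu]_(x in Om)
    (U x * (n.+1%:R * (phi x - phi (x - n.+1%:R^-1 *: Defs.basis i))))); last first.
  by apply/funext => n; exact: quot_pairing_shift.
apply: cvgN; have cU := continuous_measurable_rV continuous_U.
pose q n x := U x * (n.+1%:R * (phi x - phi (x - n.+1%:R^-1 *: Defs.basis i))).
have mq n : measurable_fun Om (q n).
  apply: measurable_funTS; apply: measurable_funM => //; apply: measurable_funM => //.
  apply: measurable_funB; first exact: continuous_measurable_rV.
  exact: (measurableT_comp (continuous_measurable_rV cphi) (measurable_shift_rV _)).
have qC n x : `|q n x| <= C.
  rewrite /q normrM -[C]mul1r ler_pM// normrM normr_nat mulrC -ler_pdivlMr//.
  by apply: phiC; rewrite invr_ge0.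
have qcvg x : q n x @[n --> \oo] --> U x * partial i phi x.
  by apply: cvgM; [exact: cvg_cst|exact: test_function_quot_cvg tphi].
apply: (@fine_cvg R nat \oo _ (fun n => (\int[mu]_(x in Om) (q n x)%:E)%E)).
rewrite fineK; last first.
  apply: integrable_fin_num => //.
  apply: (@bounded_integrable _ _ _ _ _ _ C) => //.
    apply: measurable_funTS; apply: measurable_funM => //.
    by apply: continuous_measurable_rV; exact: test_function_partial_continuous tphi.
  move=> x _; apply: (ler_cvg_to (a := \oo) (f := fun n => `|q n x|) (g := fun=> C)).
  - by apply: cvg_norm; exact: qcvg.
  - exact: cvg_cst.
  - by apply: nearW => n; exact: qC.
apply: (@dominated_cvg _ _ _ mu Om mOm (fun n x => (q n x)%:E) _ (fun=> C%:E)) => //.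
- by move=> n; apply/measurable_EFinP; exact: mq.
- by move=> x _; apply: cvg_EFin; [exact: nearW|exact: qcvg].
- by apply: (@bounded_integrable _ _ _ _ _ (fun=> C) C) => // x _; rewrite ger0_norm.
- by move=> n x _; rewrite lee_fin; exact: qC.
Qed.

End lipschitz_gradient.

(** * Sup norms *)

Section Linf.
Context {R : realType} {N : nat}.
Implicit Types (D V : set 'rV[R]_N) (f : 'rV[R]_N -> R).
Let mu := @lebesgue_rV R N.

(** The norm at +oo is an essential supremum under the condition that the whole space has positive
    measure. *)
Lemma Linf_normE D f :
  Linf_norm D f = ess_sup_inf.ess_sup mu (abse \o (EFin \o (f \_ D))).
Proof.
rewrite /Linf_norm unlock ifT//; apply: lebesgue_rV_open_gt0; first exact: openT.
by exists 0.
Qed.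

Lemma Linf_norm_ae D f : {ae mu, forall x, D x -> (`|f x|%:E <= Linf_norm D f)%E}.
Proof.
apply: filterS (ess_sup_inf.ess_sup_ge mu (abse \o (EFin \o (f \_ D)))) => x.
by rewrite Linf_normE => + Dx; rewrite /= patchE mem_set.
Qed.

Lemma Linf_norm_le D f (C : R) : 0 <= C ->
  {ae mu, forall x, D x -> `|f x| <= C} -> (Linf_norm D f <= C%:E)%E.
Proof.
move=> C0 fC; rewrite Linf_normE; apply/ess_sup_inf.ess_supP.
apply: filterS fC => x fC; rewrite /= lee_fin patchE; case: ifPn => [|_].
  by rewrite in_setE.
by rewrite normr0.
Qed.

(** A nonempty open set has positive measure, so some point of V escapes the exceptional null
    set. *)
Lemma Linf_norm_ge D V f (a : R) : open V -> V !=set0 -> V `<=` D ->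
  (forall x, V x -> a <= `|f x|) -> (a%:E <= Linf_norm D f)%E.
Proof.
move=> oV V0 VD fa; have [A [mA A0 hA]] := Linf_norm_ae D f.
have [x Vx nAx] : exists2 x, V x & ~ A x.
  apply: contrapT => /forall2NP h.
  have VA : V `<=` A by move=> x Vx; case: (h x) => // /contrapT.
  have := lebesgue_rV_open_gt0 oV V0.
  rewrite (subset_measure0 _ _ VA) ?ltxx//; exact: open_measurable_rV.
apply: (@le_trans _ _ `|f x|%:E); first by rewrite lee_fin fa.
apply: contrapT => nx; apply: nAx; apply: hA => /= hx; apply: nx.
by apply: hx; exact: VD.
Qed.

End Linf.

(** * The norms of the solution, of the distance and of the gradient *)

Section gradient_norm.
Context {R : realType} {N : nat} (Om : set 'rV[R]_N) (x0 : 'rV[R]_N).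
Variable u : 'rV[R]_N -> R.
Hypotheses (N0 : (0 < N)%N) (dom : is_domain Om) (bOm : bounded_set Om).
Hypotheses (Ox0 : Om x0) (hu : dirichlet_solution Om x0 u).
Let mu := @lebesgue_rV R N.
Let L := (dist_boundary Om x0)^-1.
Let U := extension Om u.

Let oOm : open Om. Proof. by case: dom. Qed.

Let r0 : 0 < dist_boundary Om x0. Proof. exact: (dist_boundary_gt0 N0 dom bOm Ox0). Qed.

Let L0 : 0 <= L. Proof. by rewrite /L invr_ge0 ltW. Qed.

Let lipU x y : `|U x - U y| <= L * enorm (x - y).
Proof. exact: extension_lip. Qed.

Let U01 x : 0 <= U x <= 1. Proof. exact: (extension_bound dom bOm Ox0 hu). Qed.

Let bU x : `|U x| <= 1.
Proof. by have /andP[h0 h1] := U01 x; rewrite ger0_norm. Qed.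

Lemma Linf_norm_dirichlet : Linf_norm Om u = 1%:E.
Proof.
apply/eqP; rewrite eq_le; apply/andP; split.
  apply: Linf_norm_le => //; apply: aeW => x Ox.
  by have := bU x; rewrite /U extensionE.
apply/lee_addgt0Pr => e e0; rewrite -leeBlDr// -EFinB.
pose V := Om `&` U @^-1` `]1 - e, +oo[.
apply: (@Linf_norm_ge _ _ _ V).
- apply: openI => //; apply: open_comp; last exact: interval_open.
  by move=> x _; exact: (lipschitz_continuous lipU).
- by exists x0; split=> //=; rewrite /U (extension_x0 Ox0 hu) in_itv/= andbT gtrBl.
- by move=> x [].
- move=> x [Ox]; rewrite /U/= in_itv/= andbT extensionE// => h.
  exact: le_trans (ltW h) (ler_norm _).
Qed.

Lemma Linf_norm_dist :
  (forall x, Om x -> dist_boundary Om x <= dist_boundary Om x0) ->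
  Linf_norm Om (dist_boundary Om) = (dist_boundary Om x0)%:E.
Proof.
move=> hmax; apply/eqP; rewrite eq_le; apply/andP; split.
  apply: Linf_norm_le; first exact: ltW.
  by apply: aeW => x Ox; rewrite ger0_norm ?hmax// ltW// (dist_boundary_gt0 N0 dom bOm Ox0).
apply/lee_addgt0Pr => e e0; rewrite -leeBlDr// -EFinB.
pose V := Om `&` [set x | enorm (x - x0) < e].
apply: (@Linf_norm_ge _ _ _ V).
- apply: openI => //; apply/openP => x /= xe; exists (e - enorm (x - x0)).
    by rewrite subr_gt0.
  move=> y yx; apply: (le_lt_trans (ler_enorm_dist y x0 x)); lra.
- by exists x0; split=> //=; rewrite subrr enorm0.
- by move=> x [].
- move=> x [Ox] /= xe; apply: le_trans (ler_norm _).
  by apply: le_trans (dist_boundary_lip N0 dom bOm Ox0 x0 x); rewrite lerB// ltW.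
Qed.

Variable Lm : (nat -> R) -> R.
Hypothesis hLm : is_generalized_limit Lm.
Let g := weak_grad oOm bOm lipU hLm.

Lemma Linf_norm_grad_ge (L' : R) : 0 <= L' ->
  {ae mu, forall x, Om x -> enorm (g x) <= L'} -> L <= L'.
Proof.
move=> L'0 hae; pose d := dist_boundary Om x0; have d0 : 0 < d by exact: r0.
rewrite /L -/d -[leLHS]mul1r ler_pdivrMr// leNgt; apply/negP => L'd.
have L'd0 : 0 <= L' * d by rewrite mulr_ge0// ltW.
(* The losses are 2 L e at the far end of the segment and 2 L e from averaging over a ball of radius
   e. Their sum 4 L e is half of 1 - L' d, which leaves a contradiction. *)
pose e := d * ((1 - L' * d) / 8).
have e0 : 0 < e by rewrite mulr_gt0// divr_gt0// subr_gt0.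
have ed : e < d by rewrite /e gtr_pMr//; lra.
have Le : L * e = (1 - L' * d) / 8 by rewrite /L /e mulrA mulVf ?gt_eqF// mul1r.
have [y hy yx] := dist_boundary_adherent N0 dom bOm Ox0 x0 e0; rewrite -/d in yx.
have de : 0 < d + e by lra.
(* The boundary point y is within d + e of x0; shrinking by c gives length at most d - e. The
   e-neighbourhood of the segment then stays in the ball of radius d, hence in [Om], and the end is
   within 2 e of y. *)
pose c := (d - e) / (d + e).
have c0 : 0 <= c by rewrite divr_ge0 ?ltW// subr_gt0.
have cde : c * (d + e) = d - e by rewrite /c mulfVK// gt_eqF.
have c1 : c <= 1 by rewrite ler_pdivrMr// mul1r; lra.
pose w := c *: (y - x0).
have wd : enorm w <= d - e by rewrite enormZ ger0_norm// -cde ler_wpM2l// ltW.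
have Uw : U (x0 + w) <= L * (2 * e).
  have Uy : U y = 0 by apply: extension_out; case/(open_boundary _ oOm): hy.
  apply: (@le_trans _ _ (L * enorm (x0 + w - y))).
    by have := lipU (x0 + w) y; rewrite Uy subr0; exact: le_trans (ler_norm _).
  rewrite ler_wpM2l// -enormN.
  rewrite (_ : - (x0 + w - y) = (1 - c) *: (y - x0)); last first.
    by rewrite scalerBl scale1r opprB opprD addrA.
  rewrite enormZ ger0_norm ?subr_ge0//.
  apply: (@le_trans _ _ ((1 - c) * (d + e))); first by rewrite ler_wpM2l ?subr_ge0// ltW.
  by rewrite mulrBl cde; lra.
have hO (t : R) x : 0 <= t <= 1 -> enorm (x - x0) < e -> Om (x + t *: w).
  move=> /andP[t0 t1] xe; apply: (dist_boundary_ball dom Ox0).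
  rewrite addrAC; apply: (le_lt_trans (ler_enormD _ _)).
  have : enorm (t *: w) <= d - e.
    rewrite enormZ ger0_norm//; apply: le_trans wd.
    by rewrite ler_piMl// enorm_ge0.
  by rewrite -/d; lra.
have := weak_grad_lower L0 bU L'0 e0 hae hO.
rewrite {1}/U (extension_x0 Ox0 hu) -mulrA (mulrCA 2) => h.
have : L' * enorm w <= L' * d by rewrite ler_wpM2l//; lra.
by rewrite mulrCA in Uw; lra.
Qed.

Let cU : continuous U. Proof. exact: (lipschitz_continuous lipU). Qed.

Let mOm : measurable Om. Proof. exact: open_measurable_rV. Qed.

Lemma compact_measurable_rV (K : set 'rV[R]_N) : compact K -> measurable K.
Proof.
by move=> cK; apply: closed_measurable_rV; exact: compact_closed.
Qed.

Lemma weak_gradient_dirichlet : weak_gradient Om u g.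
Proof.
have mU := continuous_measurable_rV cU.
have mu_ : measurable_fun Om u.
  apply: (@eq_measurable_fun _ _ _ _ _ U); last exact: measurable_funTS.
  by move=> x; rewrite inE => Ox; rewrite /U extensionE.
split.
  split=> // K cK KO; have mK := compact_measurable_rV cK.
  apply: (@bounded_integrable _ _ _ _ _ _ 1) => //.
  - by apply: lebesgue_rV_bounded => //; exact: compact_bounded.
  - exact: measurable_funS mu_.
  - by move=> x /KO Ox; have := bU x; rewrite /U extensionE.
move=> i; have ig B : measurable B -> mu.-integrable B (EFin \o (fun x => g x ord0 i)).
  move=> mB; have := weak_grad_integrable oOm bOm lipU hLm (Defs.basis i) mB.
  by congr (_.-integrable _ _); apply/funext => x /=; rewrite dotC dot_basisr.
split.
  split=> [|K cK _]; last by apply: ig; exact: compact_measurable_rV.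
  by apply/measurable_EFinP; exact: measurable_int (ig _ mOm).
move=> phi tphi.
rewrite -(weak_grad_parts oOm bOm lipU hLm bU i (fun x => @extension_out _ _ Om u x) tphi).
by apply: eq_Rintegral => x; rewrite inE => Ox; rewrite /U extensionE.
Qed.

Lemma Linf_norm_gradient : Linf_norm Om (fun x => enorm (g x)) = L%:E.
Proof.
apply/eqP; rewrite eq_le; apply/andP; split.
  apply: Linf_norm_le => //; apply: filterS (weak_grad_le oOm bOm L0 lipU hLm) => x h Ox.
  by rewrite ger0_norm ?enorm_ge0//; exact: h.
have ge0 : (0%:E <= Linf_norm Om (fun x => enorm (g x)))%E.
  by apply: (@Linf_norm_ge _ _ _ Om) => //; exists x0.
have hae := Linf_norm_ae Om (fun x => enorm (g x)).
move: (Linf_norm _ _) ge0 hae => [s| |]// s0 hae; last by rewrite leey.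
rewrite lee_fin; apply: Linf_norm_grad_ge; first by rewrite -lee_fin.
apply: filterS hae => x h Ox; move: (h Ox).
by rewrite lee_fin; exact: le_trans (ler_norm _).
Qed.

End gradient_norm.

Theorem proposition3p15 (R : realType) (N : nat) (hN : (2 <= N)%N)
  (Omega : set 'rV[R]_N) (hdom : is_domain Omega)
  (hbounded : bounded_set Omega) (hsmooth : smooth_boundary Omega)
  (x0 : 'rV[R]_N) (hx0 : Omega x0)
  (u : 'rV[R]_N -> R) (hu : dirichlet_solution Omega x0 u) :
  (forall x, (Omega `\ x0) x -> 0 < u x < 1) /\
  ((forall x, Omega x -> dist_boundary Omega x <= dist_boundary Omega x0) ->
   Linf_norm Omega u = 1%:E /\
   exists g : 'rV[R]_N -> 'rV[R]_N,
     weak_gradient Omega u g /\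
     Linf_norm Omega (fun x => enorm (g x)) =
       ((Linf_norm Omega (dist_boundary Omega))^-1)%E).
Proof.
have N0 : (0 < N)%N by exact: ltnW.
split=> [x [Ox xx0]|hmax].
  by rewrite (dirichlet_gt0 hdom hbounded hx0 hu)// (dirichlet_lt1 hdom hbounded hx0 hu).
split; first exact: (Linf_norm_dirichlet N0 hdom hbounded hx0 hu).
have [Lm hLm] := generalized_limit_exists R.
eexists; split; first exact: (weak_gradient_dirichlet N0 hdom hbounded hx0 hu hLm).
rewrite (Linf_norm_gradient N0 hdom hbounded hx0 hu hLm) (Linf_norm_dist N0 hdom hbounded hx0 hmax).
(* The extended inverse treats 0 separately, hence the appeal to positivity of the distance. *)
by rewrite inver gt_eqF// (dist_boundary_gt0 N0 hdom hbounded hx0).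
Qed.
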